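(* Let $\phi:\mathcal Y(J_{1212})\to\mathrm{Frac}\,\mathcal W(C_2)$ and $\phi':\mathcal Y(J_{2121})\to\mathrm{Frac}\,\mathcal W(C_2)$ be given on generators by $$\phi:\ Y_1\mapsto\kappa_2^{-1}e^{p_2-u_2-2p_1},\ Y_2\mapsto\kappa_2\kappa_4^{-1}e^{p_2+u_2+p_4-u_4-2p_3},\ Y_3\mapsto\kappa_4e^{p_4+u_4},\ Y_4\mapsto\kappa_1^{-1}e^{p_1-u_1},\ Y_5\mapsto\kappa_1\kappa_3^{-1}e^{p_1+u_1+p_3-u_3-p_2},\ Y_6\mapsto\kappa_3e^{p_3+u_3-p_4},$$ $$\phi':\ Y_1'\mapsto\kappa_4^{-1}e^{p_4-u_4},\ Y_2'\mapsto\kappa_4\kappa_2^{-1}e^{p_4+u_4+p_2-u_2-2p_3},\ Y_3'\mapsto\kappa_2e^{p_2+u_2-2p_1},\ Y_4'\mapsto\kappa_3^{-1}e^{p_3-u_3-p_4},\ Y_5'\mapsto\kappa_3\kappa_1^{-1}e^{p_3+u_3+p_1-u_1-p_2},\ Y_6'\mapsto\kappa_1e^{p_1+u_1},$$ and let $\pi^K_{1234}$ be the automorphism of $\mathcal W(C_2)$ (and of $\mathrm{Frac}\,\mathcal W(C_2)$) given, in the sense of exponentials, by $$p_1\mapsto p_1+\lambda_{24},\quad p_2\mapsto p_4+2p_1+\lambda_{24},\quad p_3\mapsto p_3-\lambda_{24},\quad p_4\mapsto p_2-2p_1-\lambda_{24},$$ $$u_1\mapsto u_1+u_2-u_4,\quad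 u_2\mapsto u_4,\quad u_3\mapsto u_3,\quad u_4\mapsto u_2.$$ (i) $\phi$ and $\phi'$ are morphisms of skew fields. Moreover $$\pi^K_{1234}\circ\phi'=\phi\circ\tau_{2,+}\tau_{5,+}\tau_{2,-}$$ as maps $\mathcal Y(J_{2121})\to\mathrm{Frac}\,\mathcal W(C_2)$, where $\tau_{2,+}\tau_{5,+}\tau_{2,-}:\mathcal Y(J_{2121})\to\mathcal Y(J_{1212})$ is the isomorphism $$(Y'_1,\dots,Y'_6)\mapsto\big(Y_1,\ Y_2,\ Y_3,\ q^{-1}Y_4Y_5,\ q^2Y_5^{-1}Y_2^{-1},\ q^{-3}Y_6Y_2Y_5\big).$$ (ii) $\pi^K_{1234}$ is realized as the adjoint action $\mathrm{Ad}(P^K_{1234})$, $x\mapsto P^K_{1234}\,x\,(P^K_{1234})^{-1}$, of $$P^K_{1234}=\rho_{24}\,e^{\frac1\hbar p_1(u_4-u_2)}\,e^{\frac{\lambda_{24}}{2\hbar}(2u_3-2u_1+u_4-u_2)},$$ where $\rho_{24}\in\mathfrak S_4$ is the permutation of the indices $2$ and $4$ of the generators of $\mathcal W(C_2)$ (not acting on indices of the parameters).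
   Context: $\hbar$ is a generic complex parameter, $q=e^\hbar$; $\lambda_1,\dots,\lambda_4\in\mathbb C$, $\kappa_j=e^{\lambda_j}$, $\lambda_{jk}=\lambda_j-\lambda_k$. A weighted quiver on $I$ with weights $d_i$ and skew-symmetric $\sigma=(\sigma_{ij})$ (a solid arrow $i\to j$ contributes $\sigma_{ij}=-\sigma_{ji}=1$, a dashed arrow $i\dashrightarrow j$ contributes $\sigma_{ij}=-\sigma_{ji}=\frac12$) determines $b_{ij}=\sigma_{ij}d_i/\gcd(d_i,d_j)$ and the skew-symmetric matrix $\widehat b_{ij}=b_{ij}d_j$. The associated skew field $\mathcal Y$ is generated by $Y_i$ ($i\in I$) with $Y_iY_j=q^{2\widehat b_{ij}}Y_jY_i$. The Fock–Goncharov quivers on $\{1,\dots,6\}$, with weights $d_1=d_2=d_3=2$, $d_4=d_5=d_6=1$, are $J_{1212}$: $1\to2$, $2\to3$, $4\to5$, $5\to6$, $2\to5$, $5\to1$, $6\to2$, $1\dashrightarrow4$, $3\dashrightarrow6$; $J_{2121}$: $1\to2$, $2\to3$, $4\to5$, $5\to6$, $5\to2$, $2\to4$, $3\to5$, $4\dashrightarrow1$, $6\dashrightarrow3$. $Y_i$ and $Y_i'$ denote the generators of $\mathcal Y(J_{1212})$ and $\mathcal Y(J_{2121})$. ($\tau_{2,+}\tau_{5,+}\tau_{2,-}$ is the monomial part of the mutation sequence $\mu_2\mu_5\mu_2$ between the two quivers.) $p_i,u_i$ ($i=1,\dots,4$) satisfy $[p_i,u_i]=\hbar$ for $i=1,3$,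 $[p_i,u_i]=2\hbar$ for $i=2,4$, and all other commutators vanish. $\mathcal W(C_2)$ is the $\mathbb C$-algebra generated by the resulting $q$-commuting $e^{\pm p_i},e^{\pm u_i}$, and $\mathrm{Frac}\,\mathcal W(C_2)$ its skew field of fractions. Exponentials of linear combinations are understood by the Baker–Campbell–Hausdorff (BCH) formula $e^Ae^B=e^{[A,B]/2}e^{A+B}$ ($[A,B]$ central). ''In the sense of exponentials'' means $e^{p_i}\mapsto e^{\text{image of }p_i}$, etc. The factors of $P^K_{1234}$ are formal exponentials, acting by conjugation as computed from the commutators via the BCH formula. *)

(* Defs.v *)
From HB Require Import structures.
From mathcomp Require Import all_boot all_order all_fingroup all_algebra.
From mathcomp Require Import ring reals.
From mathcomp.analysis Require Import sequences exp trigo.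
From mathcomp Require Import complex.
From mathcomp Require Import finmap monalg.

Set Implicit Arguments.
Unset Strict Implicit.
Unset Printing Implicit Defensive.

Import Order.TTheory GRing.Theory Num.Theory.

Local Open Scope ring_scope.

Record bicharacter (C : comNzRingType) (L : zmodType) := Bicharacter {
  bichar :> L -> L -> C;
  bicharDl : forall u v w, bichar (u + v) w = bichar u w * bichar v w;
  bicharDr : forall u v w, bichar u (v + w) = bichar u v * bichar u w;
  bichar0l : forall v, bichar 0 v = 1;
  bichar0r : forall v, bichar v 0 = 1
}.

(* The algebra with C-linear basis (e^v), v in L, and multiplication
   e^v e^w = chi(v, w) e^(v + w). *)
Definition twisted (C : comNzRingType) (L : zmodType)
  (chi : bicharacter C L) : Type := {malg C[L]}.

Section TwistedGroupAlgebra.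
Context {C : comNzRingType} {L : zmodType} (chi : bicharacter C L).
Local Notation T := (twisted chi).
Implicit Types (f g h : T) (v w : L).

HB.instance Definition _ := GRing.Lmodule.copy T {malg C[L]}.

Definition texp v : T := << 1 *g v >>.

Fact tmul_key : unit. Proof. exact: tt. Qed.

Definition tmul := locked_with tmul_key (fun f g : T =>
  (\sum_(v <- msupp f) \sum_(w <- msupp g)
     << f@_v * g@_w * chi v w *g v + w >>) : T).

Lemma tmulE f g : tmul f g =
  \sum_(v <- msupp f) \sum_(w <- msupp g)
     << f@_v * g@_w * chi v w *g v + w >>.
Proof. by rewrite /tmul unlock. Qed.

Lemma tmulw (d1 d2 : {fset L}) f g :
  (msupp f `<=` d1)%fset -> (msupp g `<=` d2)%fset ->
  tmul f g = \sum_(v <- d1) \sum_(w <- d2)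
     << f@_v * g@_w * chi v w *g v + w >>.
Proof.
move=> le_d1 le_d2; rewrite tmulE (big_fset_incl _ le_d1) /=.
  apply/eq_bigr=> v _; apply/big_fset_incl => // w _ /mcoeff_outdom ->.
  by rewrite mulr0 mul0r monalgU0.
move=> v _ /mcoeff_outdom fv.
by rewrite big1 => // w _; rewrite fv !mul0r monalgU0.
Qed.

Lemma tmulDl : left_distributive tmul +%R.
Proof.
move=> f1 f2 g.
rewrite [in RHS](tmulw (fsubsetUl _ (msupp f2)) (fsubset_refl _)).
rewrite [in RHS](tmulw (fsubsetUr (msupp f1) _) (fsubset_refl _)).
rewrite (tmulw (msuppD_le _ _) (fsubset_refl _)).
rewrite -big_split /=; apply/eq_bigr=> v _.
rewrite -big_split /=; apply/eq_bigr=> w _.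
by rewrite mcoeffD !mulrDl monalgUD.
Qed.

Lemma tmulDr : right_distributive tmul +%R.
Proof.
move=> f g1 g2.
rewrite [in RHS](tmulw (fsubset_refl _) (fsubsetUl _ (msupp g2))).
rewrite [in RHS](tmulw (fsubset_refl _) (fsubsetUr (msupp g1) _)).
rewrite (tmulw (fsubset_refl _) (msuppD_le _ _)).
rewrite -big_split /=; apply/eq_bigr=> v _.
rewrite -big_split /=; apply/eq_bigr=> w _.
by rewrite mcoeffD mulrDr mulrDl monalgUD.
Qed.

Lemma tmul0l : left_zero 0 tmul.
Proof. by move=> g; rewrite tmulE msupp0 big_seq_fset0. Qed.

Lemma tmul0r : right_zero 0 tmul.
Proof. by move=> f; rewrite tmulE big1 // => v _; rewrite msupp0 big_seq_fset0. Qed.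

Lemma tmulUU a b v w :
  tmul << a *g v >> << b *g w >> = << a * b * chi v w *g v + w >>.
Proof. by rewrite (tmulw msuppU_le msuppU_le) !big_seq_fset1 !mcoeffUU. Qed.

Lemma twisted_ind (P : T -> Prop) :
  P 0 -> (forall f g, P f -> P g -> P (f + g)) ->
  (forall a v, P << a *g v >>) -> forall f, P f.
Proof.
move=> P0 PD PU f; rewrite [f]monalgE.
by elim/big_ind: _ => [|x y Px Py|v _]; [exact: P0|exact: PD|exact: PU].
Qed.

Lemma tmulA : associative tmul.
Proof.
move=> f g h; elim/twisted_ind: f => [|f1 f2 IH1 IH2|a u].
- by rewrite !tmul0l.
- by rewrite 3!tmulDl IH1 IH2.
elim/twisted_ind: g => [|g1 g2 IH1 IH2|b v].
- by rewrite tmul0l tmul0r tmul0l.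
- by rewrite tmulDl !tmulDr tmulDl IH1 IH2.
elim/twisted_ind: h => [|h1 h2 IH1 IH2|c w].
- by rewrite !tmul0r.
- by rewrite 3!tmulDr IH1 IH2.
rewrite !tmulUU addrA bicharDl bicharDr; congr << _ *g _ >>; ring.
Qed.

Lemma tmul1l : left_id (texp 0) tmul.
Proof.
move=> f; elim/twisted_ind: f => [|f g IH1 IH2|a v]; first by rewrite tmul0r.
  by rewrite tmulDr IH1 IH2.
by rewrite tmulUU bichar0l mulr1 mul1r add0r.
Qed.

Lemma tmul1r : right_id (texp 0) tmul.
Proof.
move=> f; elim/twisted_ind: f => [|f g IH1 IH2|a v]; first by rewrite tmul0l.
  by rewrite tmulDl IH1 IH2.
by rewrite tmulUU bichar0r !mulr1 addr0.
Qed.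

Lemma tone_neq0 : texp 0 != 0.
Proof. by rewrite monalgU_eq0 oner_neq0. Qed.

HB.instance Definition _ := GRing.Zmodule_isNzRing.Build T
  tmulA tmul1l tmul1r tmulDl tmulDr tone_neq0.

Lemma scaleU (a b : C) v : a *: (<< b *g v >> : T) = << a * b *g v >>.
Proof. by apply/malgP => k; rewrite mcoeffZ !mcoeffU mulrnAr. Qed.

Lemma tscaleAl (a : C) f g : a *: (f * g) = a *: f * g.
Proof.
change (a *: tmul f g = tmul (a *: f) g).
elim/twisted_ind: f => [|f1 f2 IH1 IH2|b v].
- by rewrite tmul0l !scaler0 tmul0l.
- by rewrite tmulDl 2!scalerDr tmulDl IH1 IH2.
elim/twisted_ind: g => [|g1 g2 IH1 IH2|c w].
- by rewrite !tmul0r scaler0.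
- by rewrite 2!tmulDr scalerDr IH1 IH2.
by rewrite scaleU !tmulUU scaleU !mulrA.
Qed.

HB.instance Definition _ := GRing.Lmodule_isLalgebra.Build C T tscaleAl.

Lemma tscaleAr (a : C) f g : a *: (f * g) = f * (a *: g).
Proof.
change (a *: tmul f g = tmul f (a *: g)).
elim/twisted_ind: f => [|f1 f2 IH1 IH2|b v].
- by rewrite !tmul0l scaler0.
- by rewrite 2!tmulDl scalerDr IH1 IH2.
elim/twisted_ind: g => [|g1 g2 IH1 IH2|c w].
- by rewrite tmul0r !scaler0 tmul0r.
- by rewrite tmulDr 2!scalerDr tmulDr IH1 IH2.
rewrite scaleU !tmulUU scaleU; congr << _ *g _ >>; ring.
Qed.

HB.instance Definition _ := GRing.Lalgebra_isAlgebra.Build C T tscaleAr.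

Lemma texpM v w : texp v * texp w = chi v w *: texp (v + w).
Proof. by rewrite scaleU [LHS]tmulUU mulr1 mul1r mulr1. Qed.

End TwistedGroupAlgebra.

(* K is the skew field of (right) fractions of A, through iota. *)
Record skew_field_of_fractions (C : fieldType) (A : algType C)
  (K : unitAlgType C) (iota : {lrmorphism A -> K}) : Prop := {
  fracU : forall x : K, x != 0 -> x \is a GRing.unit;
  frac_inj : injective iota;
  fracP : forall x : K, exists a b : A, b != 0 /\ x = iota a / iota b
}.

Definition unique_morphism (C : fieldType) (A B : algType C)
    (P : (A -> B) -> Prop) : Prop :=
  (exists f : {lrmorphism A -> B}, P f) /\
  (forall f g : {lrmorphism A -> B}, P f -> P g -> f =1 g).

Definition unique_isomorphism (C : fieldType) (A B : algType C)
    (P : (A -> B) -> Prop) : Prop :=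
  unique_morphism P /\ (forall f : {lrmorphism A -> B}, P f -> bijective f).

(* Locked, so that unification does not unfold it. *)
HB.lock Definition cexp {R : realType} (z : R[i]) : R[i] :=
  Complex (expR (complex.Re z) * cos (complex.Im z))
          (expR (complex.Re z) * sin (complex.Im z)).

Section ComplexExp.
Context {R : realType}.

Lemma cexp0 : cexp (0 : R[i]) = 1.
Proof. by rewrite cexp.unlock /= expR0 cos0 sin0 mulr1 mulr0. Qed.

Lemma cexpD (a b : R[i]) : cexp (a + b) = cexp a * cexp b.
Proof.
case: a b => [a1 a2] [b1 b2]; rewrite cexp.unlock /= expRD cosD sinD.
by congr Complex; ring.
Qed.

End ComplexExp.

Section QuantumTorus.
Context {R : realType} {n : nat} (om : 'M[R[i]]_n).
Local Notation C := R[i].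
Local Notation L := 'rV[int]_n.
Implicit Types u v w : L.

(* If formal symbols x_0, ..., x_(n-1) have central commutators
   [x_i, x_j] = om i j, then cform v w is the commutator of
   \sum_i v_i x_i and \sum_j w_j x_j. *)
Definition cform v w : C :=
  \sum_i \sum_j (v 0 i)%:~R * (w 0 j)%:~R * om i j.

Lemma cformDl u v w : cform (u + v) w = cform u w + cform v w.
Proof.
rewrite /cform -big_split /=; apply: eq_bigr => i _.
rewrite -big_split /=; apply: eq_bigr => j _.
by rewrite mxE intrD !mulrDl.
Qed.

Lemma cformDr u v w : cform u (v + w) = cform u v + cform u w.
Proof.
rewrite /cform -big_split /=; apply: eq_bigr => i _.
rewrite -big_split /=; apply: eq_bigr => j _.
by rewrite mxE intrD mulrDr mulrDl.
Qed.

Lemma cform0l v : cform 0 v = 0.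
Proof.
by rewrite /cform big1 // => i _; rewrite big1 // => j _; rewrite mxE !mul0r.
Qed.

Lemma cform0r v : cform v 0 = 0.
Proof.
rewrite /cform big1 // => i _; rewrite big1 // => j _.
by rewrite mxE mulr0 mul0r.
Qed.

Lemma cform_delta i j : cform (delta_mx 0 i) (delta_mx 0 j) = om i j.
Proof.
rewrite /cform (bigD1 i) //= [X in _ + X]big1 => [|k /negPf nk].
  rewrite addr0 (bigD1 j) //= [X in _ + X]big1 => [|k /negPf nk].
    by rewrite !mxE !eqxx !mul1r addr0.
  by rewrite !mxE nk mulr0 mul0r.
by rewrite big1 // => l _; rewrite mxE nk !mul0r.
Qed.

(* The factor e^([v, w] / 2) of the Baker-Campbell-Hausdorff formula
   e^v e^w = e^([v, w] / 2) e^(v + w). *)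
Definition bch_factor v w : C := cexp (cform v w / 2).

Fact bch_factorDl u v w :
  bch_factor (u + v) w = bch_factor u w * bch_factor v w.
Proof. by rewrite /bch_factor cformDl mulrDl cexpD. Qed.

Fact bch_factorDr u v w :
  bch_factor u (v + w) = bch_factor u v * bch_factor u w.
Proof. by rewrite /bch_factor cformDr mulrDl cexpD. Qed.

Fact bch_factor0l v : bch_factor 0 v = 1.
Proof. by rewrite /bch_factor cform0l mul0r cexp0. Qed.

Fact bch_factor0r v : bch_factor v 0 = 1.
Proof. by rewrite /bch_factor cform0r mul0r cexp0. Qed.

Definition bch : bicharacter C L :=
  Bicharacter bch_factorDl bch_factorDr bch_factor0l bch_factor0r.

(* The algebra generated by the exponentials e^(x_i) and their inverses; texp v
   stands for the exponential of \sum_i v_i x_i. *)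
Definition qtorus : Type := twisted bch.

HB.instance Definition _ := GRing.Algebra.on qtorus.

Definition qexp v : qtorus := texp bch v.

Lemma qexpM v w : qexp v * qexp w = cexp (cform v w / 2) *: qexp (v + w).
Proof. exact: texpM. Qed.

Lemma qexp_comm v w : cform w v = - cform v w ->
  qexp v * qexp w = cexp (cform v w) *: (qexp w * qexp v).
Proof.
move=> skew; rewrite [LHS]qexpM [in RHS]qexpM scalerA -cexpD skew (addrC w).
suff -> : cform v w + - cform v w / 2 = cform v w / 2 by [].
by rewrite {1}[cform v w]splitr mulNr addrK.
Qed.

End QuantumTorus.

(* Labels of generators start at 1. *)
Definition lbl {n : nat} (k : nat) : 'I_n.+1 := inord k.-1.

Record wquiver (n : nat) := WQuiver {
  weight : 'I_n -> nat;
  solid : seq (nat * nat);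
  dashed : seq (nat * nat)
}.

Section Quiver.
Context {n : nat} (Q : wquiver n).

Definition arrow_count (s : seq (nat * nat)) (i j : 'I_n) : rat :=
  (count_mem (i.+1, j.+1) s)%:R.

Definition sigma (i j : 'I_n) : rat :=
  (arrow_count (solid Q) i j - arrow_count (solid Q) j i) +
  (arrow_count (dashed Q) i j - arrow_count (dashed Q) j i) / 2.

Definition bmat (i j : 'I_n) : rat :=
  sigma i j * (weight Q i)%:R / (gcdn (weight Q i) (weight Q j))%:R.

Definition bhat (i j : 'I_n) : rat := bmat i j * (weight Q j)%:R.

Lemma bhat_skew i j : bhat j i = - bhat i j.
Proof.
rewrite /bhat /bmat (gcdnC (weight Q j)) /sigma; ring.
Qed.

End Quiver.

Section YAlgebra.
Context {R : realType} (hbar : R[i]) {n : nat} (Q : wquiver n.+1).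

(* Y_i = e^(y_i) with [y_i, y_j] = 2 bhat_ij hbar. *)
Definition Yform : 'M[R[i]]_n.+1 := \matrix_(i, j) (2 * ratr (bhat Q i j) * hbar).

Definition Ytorus : Type := qtorus Yform.

HB.instance Definition _ := GRing.Algebra.on Ytorus.

Definition Ygen (i : 'I_n.+1) : Ytorus := qexp Yform (delta_mx 0 i).

Lemma Ygen_comm i j :
  Ygen i * Ygen j = cexp (2 * ratr (bhat Q i j) * hbar) *: (Ygen j * Ygen i).
Proof.
rewrite [LHS]qexp_comm; first by rewrite cform_delta mxE.
by rewrite !cform_delta !mxE bhat_skew raddfN /= mulrN mulNr.
Qed.

End YAlgebra.

Definition FG_weight (i : 'I_6) : nat := if (i < 3)%N then 2 else 1.

Definition J1212 : wquiver 6 := WQuiver FG_weight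
  [:: (1, 2); (2, 3); (4, 5); (5, 6); (2, 5); (5, 1); (6, 2)]%N
  [:: (1, 4); (3, 6)]%N.

Definition J2121 : wquiver 6 := WQuiver FG_weight
  [:: (1, 2); (2, 3); (4, 5); (5, 6); (5, 2); (2, 4); (3, 5)]%N
  [:: (4, 1); (6, 3)]%N.

(* [p_i, u_i] = Wweight i * hbar; recall that the first index is 0 here. *)
Definition Wweight (i : 'I_4) : nat := if odd i then 2 else 1.

Definition pvec (i : 'I_4) : 'rV[int]_(4 + 4) := delta_mx 0 (lshift 4 i).
Definition uvec (i : 'I_4) : 'rV[int]_(4 + 4) := delta_mx 0 (rshift 4 i).
Definition p_ (k : nat) := pvec (lbl k).
Definition u_ (k : nat) := uvec (lbl k).

Section Proposition.
Context {R : realType} (hbar : R[i]) (lam : 'I_4 -> R[i]).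
Local Notation C := R[i].
Local Notation L := 'rV[int]_(4 + 4).

Definition Wform : 'M[C]_(4 + 4) :=
  let D := diag_mx (\row_i ((Wweight i)%:R * hbar)) in block_mx 0 D (- D) 0.

Definition WC2 : Type := qtorus Wform.

HB.instance Definition _ := GRing.Algebra.on WC2.

Definition Wexp (v : L) : WC2 := qexp Wform v.

Definition lam2 (j k : nat) : C := lam (lbl j) - lam (lbl k).
Definition kappa (k : nat) : C := cexp (lam (lbl k)).

Section Morphisms.
Context {F : algType C} (e : L -> F).

Definition phi_spec (Y : algType C) (y : 'I_6 -> Y) (phi : Y -> F) : Prop :=
  [seq phi (y (lbl k)) | k <- iota 1 6] =
  [:: (kappa 2)^-1 *: e (p_ 2 - u_ 2 - p_ 1 *+ 2);
      (kappa 2 * (kappa 4)^-1) *: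
        e (p_ 2 + u_ 2 + p_ 4 - u_ 4 - p_ 3 *+ 2);
      kappa 4 *: e (p_ 4 + u_ 4);
      (kappa 1)^-1 *: e (p_ 1 - u_ 1);
      (kappa 1 * (kappa 3)^-1) *: e (p_ 1 + u_ 1 + p_ 3 - u_ 3 - p_ 2);
      kappa 3 *: e (p_ 3 + u_ 3 - p_ 4)].

Definition phi'_spec (Y' : algType C) (y' : 'I_6 -> Y') (phi' : Y' -> F) :
    Prop :=
  [seq phi' (y' (lbl k)) | k <- iota 1 6] =
  [:: (kappa 4)^-1 *: e (p_ 4 - u_ 4);
      (kappa 4 * (kappa 2)^-1) *:
        e (p_ 4 + u_ 4 + p_ 2 - u_ 2 - p_ 3 *+ 2);
      kappa 2 *: e (p_ 2 + u_ 2 - p_ 1 *+ 2);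
      (kappa 3)^-1 *: e (p_ 3 - u_ 3 - p_ 4);
      (kappa 3 * (kappa 1)^-1) *: e (p_ 3 + u_ 3 + p_ 1 - u_ 1 - p_ 2);
      kappa 1 *: e (p_ 1 + u_ 1)].

Definition piK_spec (piK : F -> F) : Prop :=
  [seq piK (e (p_ k)) | k <- iota 1 4] =
  [:: cexp (lam2 2 4) *: e (p_ 1);
      cexp (lam2 2 4) *: e (p_ 4 + p_ 1 *+ 2);
      cexp (- lam2 2 4) *: e (p_ 3);
      cexp (- lam2 2 4) *: e (p_ 2 - p_ 1 *+ 2)] /\
  [seq piK (e (u_ k)) | k <- iota 1 4] =
  [:: e (u_ 1 + u_ 2 - u_ 4); e (u_ 4); e (u_ 3); e (u_ 2)].

End Morphisms.

Definition tau_spec (Y Y' : unitAlgType C) (y : 'I_6 -> Y) (y' : 'I_6 -> Y')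
    (tau : Y' -> Y) : Prop :=
  let q := cexp hbar in
  [seq tau (y' (lbl k)) | k <- iota 1 6] =
  [:: y (lbl 1); y (lbl 2); y (lbl 3);
      q^-1 *: (y (lbl 4) * y (lbl 5));
      q ^+ 2 *: ((y (lbl 5))^-1 * (y (lbl 2))^-1);
      q ^- 3 *: (y (lbl 6) * y (lbl 2) * y (lbl 5))].

Section AdjointAction.
Context {A : algType C}.
Implicit Types X Y Z : A.

Definition lie X Y : A := X * Y - Y * X.

Record heisenberg (p u : 'I_4 -> A) : Prop := {
  lie_pu : forall i j, lie (p i) (u j) =
             (if i == j then (Wweight i)%:R * hbar else 0)%:A;
  lie_pp : forall i j, lie (p i) (p j) = 0;
  lie_uu : forall i j, lie (u i) (u j) = 0
}.

(* Z = e^X Y e^(-X) = Y + [X, Y] + [X, [X, Y]] / 2! + ..., for X whose iterated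
   commutators with Y eventually vanish. *)
Definition exp_ad X Y Z : Prop :=
  exists N, iter N (lie X) Y = 0 /\
    Z = \sum_(k < N) (k`!%:R : C)^-1 *: iter k (lie X) Y.

Context (p u : 'I_4 -> A).

Definition lin (v : L) : A :=
  \sum_(i < 4) (p i *~ v 0 (lshift 4 i) + u i *~ v 0 (rshift 4 i)).

Inductive factor : Type :=
  | Perm (s : 'S_4)
  | Exp (X : A).

(* Conjugation by a formal factor, acting on the exponentials e v of v in L:
   a permutation of the indices acts on the generators, and
   e^X e^v e^(-X) = e^(e^X v e^(-X)) where e^X v e^(-X) = w + c with w in L and
   c a scalar. *)
Definition Ad_factor {E : algType C} (e : L -> E) (f : factor) (a : E -> E) :
    Prop :=
  match f with
  | Perm s => forall i, a (e (pvec i)) = e (pvec (s i)) /\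
                        a (e (uvec i)) = e (uvec (s i))
  | Exp X => forall v, exists (w : L) (c : C),
      exp_ad X (lin v) (lin w + c%:A) /\ a (e v) = cexp c *: e w
  end.

(* a is x |-> P x P^-1, where P is the product of a list of factors. *)
Fixpoint Ad {E : algType C} (e : L -> E) (P : seq factor) (a : E -> E) : Prop :=
  match P with
  | [::] => a =1 id
  | f :: P' => exists b c : {lrmorphism E -> E},
      [/\ Ad_factor e f b, Ad e P' c & a =1 b \o c]
  end.

Definition PK : seq factor :=
  [:: Perm (tperm (lbl 2) (lbl 4));
      Exp (hbar^-1 *: (p (lbl 1) * (u (lbl 4) - u (lbl 2))));
      Exp ((lam2 2 4 / (2 * hbar)) *:
             (2 *: u (lbl 3) - 2 *: u (lbl 1) + u (lbl 4) - u (lbl 2)))].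

End AdjointAction.

End Proposition.

(* Main.v *)
Require Import Defs.
From HB Require Import structures.
From mathcomp Require Import all_boot all_order all_algebra.
From mathcomp Require Import reals complex.
From mathcomp Require Import perm finmap monalg ring.
Import GRing.Theory.
Local Open Scope ring_scope.

(* All maps of the statement are monomial: they send e^v to a scalar multiple of
   e^(v M), for an integer matrix M and a scalar depending exponentially on v.
   Such an assignment is multiplicative as soon as M preserves the commutator
   form. Nondegeneracy of the form on the source then forces M, hence the
   morphism, to be injective, so that it extends to skew fields of fractions;
   there it is determined by its values on the generators. The identities of the
   proposition reduce in this way to identities between integer matrices and
   between linear forms in the lambda_j. The matrix of pi^K factors as a shear,
   which is exp(ad(p_1 (u_4 - u_2) / hbar)) restricted to linear forms, followed
   by the transposition of the indices 2 and 4. *)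

Set Implicit Arguments.
Unset Strict Implicit.
Unset Printing Implicit Defensive.

(** * Twisted group algebras *)

Section TwistedLift.
Context {C : comNzRingType} {L : zmodType} {chi : bicharacter C L}.
Context {B : algType C} (g : L -> B).

Definition tlift (f : twisted chi) : B := \sum_(v <- msupp f) f@_v *: g v.

(** Coefficients vanish off the support, so the sum may run over a larger finite set; linearity
    compares three sums over one common set. *)
Lemma tliftw (d : {fset L}) (f : twisted chi) :
  (msupp f `<=` d)%fset -> tlift f = \sum_(v <- d) f@_v *: g v.
Proof.
move=> le_d; apply: (big_fset_incl _ le_d) => v _ /mcoeff_outdom ->.
by rewrite scale0r.
Qed.

Lemma tlift_is_linear : linear tlift.
Proof.
move=> a f h.
have le_af := fsubset_trans (msuppZ_le a f) (fsubsetUl _ (msupp h)).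
have le_f : (msupp f `<=` msupp f `|` msupp h)%fset by exact: fsubsetUl.
have le_h : (msupp h `<=` msupp f `|` msupp h)%fset by exact: fsubsetUr.
have le_s : (msupp (a *: f + h : {malg C[L]}) `<=` msupp f `|` msupp h)%fset.
  apply: fsubset_trans (msuppD_le _ _) _.
  by rewrite fsubUset le_af le_h.
rewrite (tliftw le_s) (tliftw le_f) (tliftw le_h) scaler_sumr -big_split /=.
by apply: eq_bigr => v _; rewrite mcoeffD mcoeffZ scalerDl scalerA.
Qed.

HB.instance Definition _ := GRing.isLinear.Build C (twisted chi) B _ tlift
  tlift_is_linear.

Lemma tliftU a v : tlift << a *g v >> = a *: g v.
Proof. by rewrite (tliftw msuppU_le) big_seq_fset1 mcoeffUU. Qed.

Hypotheses (gM : forall v w, g v * g w = chi v w *: g (v + w)) (g0 : g 0 = 1).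

Lemma tlift_is_monoid_morphism : monoid_morphism tlift.
Proof.
split=> [|f h]; first by rewrite [LHS]tliftU scale1r.
elim/(@twisted_ind _ _ chi): f => [|f1 f2 IH1 IH2|a v].
- by rewrite mul0r !linear0 mul0r.
- by rewrite mulrDl !linearD /= mulrDl IH1 IH2.
elim/(@twisted_ind _ _ chi): h => [|f1 f2 IH1 IH2|b w].
- by rewrite mulr0 !linear0 mulr0.
- by rewrite mulrDr !linearD /= mulrDr IH1 IH2.
rewrite [X in tlift X]tmulUU !tliftU -scalerAl -scalerAr gM !scalerA.
by congr (_ *: _); ring.
Qed.

(** Existence half of the universal property: by bilinearity, multiplicativity need only be checked
    on the basis, where it is [gM]. *)
Lemma twisted_hom :
  exists f : {lrmorphism twisted chi -> B}, forall v, f (texp chi v) = g v.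
Proof.
pose m := GRing.isMonoidMorphism.Build _ _ tlift tlift_is_monoid_morphism.
pose f : {lrmorphism twisted chi -> B} := HB.pack tlift m.
by exists f => v; rewrite [LHS]tliftU scale1r.
Qed.

End TwistedLift.

Lemma twisted_hom_uniq (C : comNzRingType) (L : zmodType)
    (chi : bicharacter C L) (B : lmodType C)
    (f g : {linear twisted chi -> B}) :
  (forall v, f (texp chi v) = g (texp chi v)) -> f =1 g.
Proof.
move=> eq_fg; elim/(@twisted_ind _ _ chi) => [|x y IHx IHy|a v].
- by rewrite !linear0.
- by rewrite !linearD IHx IHy.
by rewrite -[X in << X *g _>>]mulr1 -scaleU !linearZ_LR eq_fg.
Qed.


(** * Monomial maps between twisted group algebras *)

Section MonomialMaps.
Context {C : fieldType} {L : zmodType} {chi : bicharacter C L}.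

Lemma bichar_neq0 v w : chi v w != 0.
Proof.
apply/eqP => chi0; have := bicharDl chi v (- v) w.
by rewrite subrr bichar0l chi0 mul0r => /eqP; rewrite oner_eq0.
Qed.

(** Both sides are inverse to [chi v v]. *)
Lemma bicharNN v : chi (- v) v = chi v (- v).
Proof.
apply: (mulfI (bichar_neq0 v v)).
by rewrite -bicharDl -bicharDr subrr bichar0l bichar0r.
Qed.

Section Agreement.
Context {B : algType C} (f g : {lrmorphism twisted chi -> B}).
Implicit Types v w : L.

Let texpME (h : {lrmorphism twisted chi -> B}) v w :
  h (texp chi v) * h (texp chi w) = chi v w *: h (texp chi (v + w)).
Proof. by rewrite -rmorphM texpM /= linearZ_LR. Qed.

Let texp0E (h : {lrmorphism twisted chi -> B}) : h (texp chi 0) = 1.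
Proof. exact: rmorph1 h. Qed.

Lemma agree_texpD v w : f (texp chi v) = g (texp chi v) ->
  f (texp chi w) = g (texp chi w) ->
  f (texp chi (v + w)) = g (texp chi (v + w)).
Proof.
move=> eqv eqw; apply: (scalerI (bichar_neq0 v w)).
by rewrite -!texpME eqv eqw.
Qed.

(** Up to the scalar [chi v (- v)], the image of e^(-v) under [f] is a left inverse, and that under
    [g] a right inverse, of the common image of e^v. Such inverses coincide. *)
Lemma agree_texpN v : f (texp chi v) = g (texp chi v) ->
  f (texp chi (- v)) = g (texp chi (- v)).
Proof.
move=> eqv; apply: (scalerI (bichar_neq0 v (- v))).
have gE : chi v (- v) *: 1 = g (texp chi v) * g (texp chi (- v)).
  by rewrite texpME subrr texp0E.
have fE : chi v (- v) *: 1 = f (texp chi (- v)) * f (texp chi v).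
  by rewrite texpME addNr texp0E bicharNN.
rewrite -[in LHS](mulr1 (f _)) scalerAr gE -eqv mulrA -fE.
by rewrite -scalerAl mul1r.
Qed.

End Agreement.

Context {L' : zmodType} {chi' : bicharacter C L'}.
Context (M : {additive L -> L'}) (c : L -> C).
Hypothesis c_neq0 : forall v, c v != 0.

Lemma twisted_monomial_hom :
  (forall v w, chi' (M v) (M w) = chi v w) ->
  (forall v w, c (v + w) = c v * c w) -> c 0 = 1 ->
  exists f : {lrmorphism twisted chi -> twisted chi'},
    forall v, f (texp chi v) = c v *: texp chi' (M v).
Proof.
move=> chiM cD c0; apply: twisted_hom => [v w|]; last first.
  by rewrite c0 scale1r raddf0.
rewrite -scalerAl -scalerAr texpM !scalerA chiM raddfD cD.
by congr (_ *: _); ring.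
Qed.

Context (f : {linear twisted chi -> twisted chi'}).
Hypothesis fE : forall v, f (texp chi v) = c v *: texp chi' (M v).

Let fU a v : f << a *g v >> = (a * c v) *: texp chi' (M v).
Proof. by rewrite -[a in LHS]mulr1 -scaleU linearZ_LR fE scalerA. Qed.

(** Distinct basis vectors go to nonzero multiples of distinct basis vectors, so each coefficient of
    [x] can be recovered from [f x]. *)
Lemma twisted_monomial_inj : injective M -> injective f.
Proof.
move=> injM; apply: raddf_inj => x fx0; apply/malgP => v; rewrite mcoeff0.
suff fxE : (f x)@_(M v) = c v * x@_v.
  move: fxE; rewrite fx0 mcoeff0 => /esym/eqP.
  by rewrite mulf_eq0 (negPf (c_neq0 _)) => /eqP.
elim/(@twisted_ind _ _ chi): x {fx0} => [|x y IHx IHy|a w].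
- by rewrite linear0 !mcoeff0 mulr0.
- by rewrite linearD !mcoeffD IHx IHy mulrDr.
rewrite fU scaleU !mcoeffU (inj_eq injM) mulr1.
by case: eqVneq => [->|_]; rewrite ?mulr0n ?mulr0 // !mulr1n mulrC.
Qed.

Lemma twisted_monomial_surj :
  (forall v', exists v, M v = v') -> forall y, exists x, f x = y.
Proof.
move=> surjM; elim/(@twisted_ind _ _ chi') => [|x y [x' <-] [y' <-]|a w].
- by exists 0; rewrite linear0.
- by exists (x' + y'); rewrite linearD.
have [v <-] := surjM w; exists << a / c v *g v >>.
by rewrite fU divfK // scaleU mulr1.
Qed.

End MonomialMaps.

(** * Extension to skew fields of fractions *)

(** [bijective] asks for an inverse function; the choice structure on the source selects the
    preimages. *)
Lemma inj_surj_bij (T1 : choiceType) (T2 : eqType) (f : T1 -> T2) :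
  injective f -> (forall y, exists x, f x = y) -> bijective f.
Proof.
move=> f_inj f_surj.
have f_surjb y : exists x, f x == y by have [x <-] := f_surj y; exists x.
have gK y : f (xchoose (f_surjb y)) = y by apply/eqP/(xchooseP (f_surjb y)).
by exists (fun y => xchoose (f_surjb y)) => [x|y]; [apply: f_inj|].
Qed.

Section SkewFieldExtension.
Context {C : fieldType} {A : algType C} {K : unitAlgType C}.
Context {iota : {lrmorphism A -> K}} (HK : skew_field_of_fractions iota).

Lemma frac_unit (a : A) : a != 0 -> iota a \is a GRing.unit.
Proof.
move=> a0; apply: (fracU HK); rewrite -(rmorph0 iota).
by rewrite (inj_eq (frac_inj HK)).
Qed.

(** The algebra embeds in a skew field, where a product of units is a unit and hence nonzero. *)
Lemma frac_mulf_neq0 (a b : A) : a != 0 -> b != 0 -> a * b != 0.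
Proof.
move=> a0 b0; apply/eqP => ab0.
have /unitrP : iota a * iota b \is a GRing.unit.
  by rewrite unitrMl ?frac_unit.
by rewrite -rmorphM ab0 rmorph0 => -[x [/eqP]]; rewrite mulr0 eq_sym oner_eq0.
Qed.

Lemma frac_hom_uniq (B : algType C) (f g : {lrmorphism K -> B}) :
  f \o iota =1 g \o iota -> f =1 g.
Proof.
move=> eq_fg x; have [a [b [b0 ->]]] := fracP HK x.
have ub := frac_unit b0.
rewrite !rmorphM /=; congr (_ * _); first exact: eq_fg.

(* The target is an arbitrary algebra, so the two images of the inverse are compared as a left and a
   right inverse of one element. *)
have eqb : f (iota b) = g (iota b) := eq_fg b.
have fV : f (iota b)^-1 * f (iota b) = 1 by rewrite -rmorphM mulVr // rmorph1.
have gV : g (iota b) * g (iota b)^-1 = 1 by rewrite -rmorphM mulrV // rmorph1.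
by rewrite -[LHS]mulr1 -gV -eqb mulrA fV mul1r.
Qed.

Context {F : unitAlgType C} (FU : forall x : F, x != 0 -> x \is a GRing.unit).
Context (f : {lrmorphism A -> F}) (f_inj : injective f).

Let f_unit (a : A) : a != 0 -> f a \is a GRing.unit.
Proof. by move=> a0; apply: FU; rewrite -(rmorph0 f) (inj_eq f_inj). Qed.

Fact frac_repr (x : K) :
  exists ab : A * A, (ab.2 != 0) && (x == iota ab.1 / iota ab.2).
Proof.
by have [a [b [b0 ->]]] := fracP HK x; exists (a, b); rewrite b0 eqxx.
Qed.

(** Defined on a chosen representation of [x]; [frac_extE] shows that the choice does not matter. *)
Definition frac_ext (x : K) : F :=
  let ab := xchoose (frac_repr x) in f ab.1 / f ab.2.

(* Right fractions with denominators b and d have a common denominator since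
   b^-1 d is itself a right fraction. *)
Lemma frac_common (b d : A) : b != 0 -> d != 0 ->
  exists s t : A, [/\ s != 0, t != 0 & b * s = d * t].
Proof.
move=> b0 d0; have [ub ud] := (frac_unit b0, frac_unit d0).
have [s [t [t0 eq_st]]] := fracP HK ((iota b)^-1 * iota d).
have ut := frac_unit t0.
have eq_bs : b * s = d * t.
  apply: (frac_inj HK); rewrite !rmorphM /=.
  by rewrite -[X in _ * X](divrK ut) -eq_st mulrA mulVKr.
exists s, t; split=> //; apply/eqP => s0.
by move: (frac_mulf_neq0 d0 t0); rewrite -eq_bs s0 mulr0 eqxx.
Qed.

(** Expanding both representations to a common denominator makes the numerators equal in [A], by
    injectivity of [iota]; the expanded fractions then have the same image. *)
Lemma frac_extE (a b : A) : b != 0 -> frac_ext (iota a / iota b) = f a / f b.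
Proof.
move=> b0; rewrite /frac_ext; set x := iota a / iota b.
have /andP[] := xchooseP (frac_repr x).
case: (xchoose _) => c d /= d0 /eqP xE.
have [s [t [s0 t0 eq_st]]] := frac_common b0 d0.
have eq_ac : a * s = c * t.
  apply: (frac_inj HK); rewrite !rmorphM /=.
  rewrite -[iota a](divrK (frac_unit b0)) -[iota c](divrK (frac_unit d0)).
  by rewrite -/x -xE -!mulrA -!rmorphM eq_st.
have fE (e h u : A) : h != 0 -> u != 0 -> f e / f h = f (e * u) / f (h * u).
  move=> h0 u0; have [uh uu] := (f_unit h0, f_unit u0).
  by rewrite !rmorphM /= invrM // mulrA mulrK.
by rewrite (fE a b s) // (fE c d t) // eq_ac eq_st.
Qed.

Lemma frac_ext_iota (a : A) : frac_ext (iota a) = f a.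
Proof.
by have := frac_extE a (oner_neq0 A); rewrite !rmorph1 !divr1.
Qed.

Lemma frac_common2 (x y : K) : exists a b c : A,
  [/\ c != 0, x = iota a / iota c & y = iota b / iota c].
Proof.
have [a [b [b0 ->]]] := fracP HK x; have [c [d [d0 ->]]] := fracP HK y.
have [s [t [s0 t0 eq_st]]] := frac_common b0 d0.
exists (a * s), (c * t), (b * s); split; first exact: frac_mulf_neq0.
  by rewrite !rmorphM /= invrM ?frac_unit // mulrA mulrK ?frac_unit.
by rewrite eq_st !rmorphM /= invrM ?frac_unit // mulrA mulrK ?frac_unit.
Qed.

Lemma frac_ext_is_linear : linear frac_ext.
Proof.
move=> k x y; have [a [b [c [c0 -> ->]]]] := frac_common2 x y.
rewrite scalerAl -linearZ -mulrDl -rmorphD /= !frac_extE //.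
by rewrite linearD linearZ_LR mulrDl scalerAl.
Qed.

(** If b s = c t, then b^-1 c = s t^-1, so the product of a / b and c / d is (a s) / (d t). The same
    computation is applied to [iota] and to [f]. *)
Lemma frac_ext_is_monoid_morphism : monoid_morphism frac_ext.
Proof.
split=> [|x y]; first by rewrite -(rmorph1 iota) frac_ext_iota rmorph1.
have [a [b [b0 ->]]] := fracP HK x; have [c [d [d0 ->]]] := fracP HK y.
(* The common multiple of [b] and [c] with nonzero cofactors requires [c] to be nonzero. *)
have [-> | c0] := eqVneq c 0.
  by rewrite !rmorph0 mul0r mulr0 -(rmorph0 iota) frac_ext_iota rmorph0 mulr0.
have [s [t [s0 t0 eq_st]]] := frac_common b0 c0.
have eq_bc (E : unitAlgType C) (h : {lrmorphism A -> E}) :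
    h b \is a GRing.unit -> h t \is a GRing.unit ->
    (h b)^-1 * h c = h s / h t.
  move=> ub ut; apply: (mulrI ub); rewrite mulVKr //.
  by rewrite mulrA -rmorphM eq_st rmorphM mulrK.
have mulE (E : unitAlgType C) (h : {lrmorphism A -> E}) :
    (forall z, z != 0 -> h z \is a GRing.unit) ->
    h a / h b * (h c / h d) = h (a * s) / h (d * t).
  move=> hU; rewrite mulrA -[X in X / _]mulrA eq_bc ?hU // !rmorphM /=.
  by rewrite invrM ?hU // !mulrA.
rewrite (mulE _ iota); last exact: frac_unit.
by rewrite !frac_extE ?frac_mulf_neq0 // (mulE _ f).
Qed.

Lemma frac_hom :
  exists g : {lrmorphism K -> F}, forall a, g (iota a) = f a.
Proof.
pose l := GRing.isLinear.Build C K F _ frac_ext frac_ext_is_linear.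
pose m := GRing.isMonoidMorphism.Build _ _ frac_ext frac_ext_is_monoid_morphism.
pose g : {lrmorphism K -> F} := HB.pack frac_ext l m.
by exists g => a; exact: frac_ext_iota.
Qed.

End SkewFieldExtension.

(** Injectivity holds because a nonzero element is a unit, and units do not map to 0; for
    surjectivity, numerator and denominator are lifted through [f]. *)
Lemma frac_hom_bij (C : fieldType) (A A' : algType C) (K K' : unitAlgType C)
    (iota : {lrmorphism A -> K}) (iota' : {lrmorphism A' -> K'})
    (f : {lrmorphism A -> A'}) (g : {lrmorphism K -> K'}) :
  skew_field_of_fractions iota -> skew_field_of_fractions iota' ->
  (forall a, g (iota a) = iota' (f a)) -> bijective f -> bijective g.
Proof.
move=> HK HK' gE [f' fK f'K]; apply: inj_surj_bij => [|y].
  apply: raddf_inj => x gx0; apply/eqP; apply: contraT => /(fracU HK) ux.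
  by have := rmorph_unit g ux; rewrite gx0 unitr0.
have [a [b [b0 ->]]] := fracP HK' y.
exists (iota (f' a) / iota (f' b)).
have fb0 : f' b != 0.
  by apply: contra_neq b0 => fb0; rewrite -(f'K b) fb0 rmorph0.
by rewrite rmorphM rmorphV ?frac_unit //= !gE !f'K.
Qed.

(** * Monomial morphisms *)

Section ComplexExpTheory.
Context {R : realType}.
Implicit Types a : R[i].

Lemma cexp_unit a : cexp a \is a GRing.unit.
Proof.
by apply/unitrP; exists (cexp (- a)); rewrite -!cexpD subrr addNr cexp0.
Qed.

Lemma cexp_neq0 a : cexp a != 0.
Proof. by rewrite -unitfE cexp_unit. Qed.

Lemma cexpN a : cexp (- a) = (cexp a)^-1.
Proof.
by apply: (mulrI (cexp_unit a)); rewrite -cexpD subrr cexp0 divrr ?cexp_unit.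
Qed.

Lemma cexpMn a k : cexp (a *+ k) = cexp a ^+ k.
Proof.
by elim: k => [|k IHk]; rewrite ?cexp0 // mulrS cexpD IHk exprS.
Qed.

End ComplexExpTheory.

Section MonomialMaps.
Context {R : realType}.
Local Notation C := R[i].

Definition wt n (l : 'I_n -> C) (v : 'rV[int]_n) : C :=
  \sum_i (v 0 i)%:~R * l i.

Lemma wtD n (l : 'I_n -> C) v w : wt l (v + w) = wt l v + wt l w.
Proof.
rewrite /wt -big_split /=; apply: eq_bigr => i _.
by rewrite mxE intrD mulrDl.
Qed.

Lemma wt0 n (l : 'I_n -> C) : wt l 0 = 0.
Proof. by rewrite /wt big1 // => i _; rewrite mxE mul0r. Qed.

Lemma wt_delta n (l : 'I_n -> C) i : wt l (delta_mx 0 i) = l i.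
Proof.
rewrite /wt (bigD1 i) //= [X in _ + X]big1 => [|k /negPf nk].
  by rewrite !mxE !eqxx mul1r addr0.
by rewrite !mxE nk mul0r.
Qed.

(** Exponents are row vectors: row i of [M] is the exponent of the image of the i-th generator, and
    the matrix of the map applied first stands leftmost in a product. *)
Definition monomial n n' (A A' : lmodType C) (e : 'rV[int]_n -> A)
    (e' : 'rV[int]_n' -> A') (f : A -> A') (l : 'I_n -> C)
    (M : 'M[int]_(n, n')) : Prop :=
  forall v, f (e v) = cexp (wt l v) *: e' (v *m M).

Lemma monomial_gen n n' (A A' : lmodType C) (e : 'rV[int]_n -> A)
    (e' : 'rV[int]_n' -> A') (f : A -> A') (l : 'I_n -> C)
    (M : 'M[int]_(n, n')) :
  monomial e e' f l M ->
  forall i, f (e (delta_mx 0 i)) = cexp (l i) *: e' (row i M).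
Proof. by move=> fE i; rewrite fE wt_delta rowE. Qed.

Lemma monomial_comp n n' n'' (A A' A'' : lmodType C) (e : 'rV[int]_n -> A)
    (e' : 'rV[int]_n' -> A') (e'' : 'rV[int]_n'' -> A'') (f : A -> A')
    (g : {linear A' -> A''}) l l' (M : 'M[int]_(n, n'))
    (M' : 'M[int]_(n', n'')) :
  monomial e e' f l M -> monomial e' e'' g l' M' ->
  forall v, g (f (e v)) = cexp (wt l v + wt l' (v *m M)) *: e'' (v *m M *m M').
Proof. by move=> fE gE v; rewrite fE linearZ_LR gE scalerA cexpD. Qed.

Definition cform_isometry n n' (om : 'M[C]_n) (om' : 'M[C]_n')
    (M : 'M[int]_(n, n')) :=
  forall v w, cform om' (v *m M) (w *m M) = cform om v w.

Lemma cform_int n (h : C) (B : 'M[int]_n) v w :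
  cform (h *: map_mx intr B) v w = h * ((v *m B *m w^T) 0 0)%:~R.
Proof.
rewrite /cform exchange_big mxE rmorph_sum mulr_sumr; apply: eq_bigr => j _ /=.
rewrite !mxE rmorphM rmorph_sum mulr_suml mulr_sumr; apply: eq_bigr => i _ /=.
by rewrite !mxE intrM; ring.
Qed.

(** Factoring out the complex scalar [h] reduces the isometry condition to an identity of integer
    matrices, which can be computed. *)
Lemma isometry_int n n' (h : C) (B : 'M[int]_n) (B' : 'M[int]_n')
    (M : 'M[int]_(n, n')) :
  M *m B' *m M^T = B ->
  cform_isometry (h *: map_mx intr B) (h *: map_mx intr B') M.
Proof. by move=> <- v w; rewrite !cform_int trmx_mul !mulmxA. Qed.

(** A row vector killed by [M] is killed by M B' M^T = B, hence by B K = d. The integer [d] replaces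
    the inverse of [B] by an integral matrix. *)
Lemma isometry_inj n n' (B K : 'M[int]_n) (B' : 'M[int]_n')
    (M : 'M[int]_(n, n')) (d : int) :
  M *m B' *m M^T = B -> B *m K = d%:M -> d != 0 ->
  injective (fun v : 'rV[int]_n => v *m M).
Proof.
move=> MB BK d0 v w /= eqM; apply/eqP; rewrite -subr_eq0; apply/eqP.
have: (v - w) *m d%:M = 0.
  by rewrite -BK -MB !mulmxA mulmxBl eqM subrr !mul0mx.
rewrite mul_mx_scalar => /matrixP eq0; apply/matrixP => i j.
have := eq0 i j; rewrite !mxE => /eqP; rewrite mulf_eq0 (negPf d0) /=.
by move/eqP.
Qed.

Lemma int_row_ind n (P : 'rV[int]_n -> Prop) :
  P 0 -> (forall v w, P v -> P w -> P (v + w)) -> (forall v, P v -> P (- v)) ->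
  (forall i, P (delta_mx 0 i)) -> forall v, P v.
Proof.
move=> P0 PD PN Pdelta v.
have PMn w k : P w -> P (w *+ k).
  by move=> Pw; elim: k => [//|k IHk]; rewrite mulrS; exact: PD.
rewrite (row_sum_delta v); elim/big_ind: _ => // i _.
have -> : v 0 i *: delta_mx 0 i = delta_mx 0 i *~ v 0 i :> 'rV[int]_n.
  by rewrite -scaler_int intz.
by case: (v 0 i) => k; [exact: PMn | apply: PN; exact: PMn].
Qed.

Section Torus.
Context {n n' : nat} {om : 'M[C]_n} {om' : 'M[C]_n'}.

(** The exponents on which two morphisms agree form a subgroup of the lattice. *)
Lemma qtorus_hom_uniq (B : algType C) (f g : {lrmorphism qtorus om -> B}) :
  (forall i, f (qexp om (delta_mx 0 i)) = g (qexp om (delta_mx 0 i))) ->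
  f =1 g.
Proof.
move=> eq_gen; apply: twisted_hom_uniq; apply: int_row_ind => [|v w|v|//].
- by rewrite (rmorph1 f) (rmorph1 g).
- exact: agree_texpD.
- exact: agree_texpN.
Qed.

Lemma qtorus_hom (l : 'I_n -> C) (M : 'M[int]_(n, n')) :
  cform_isometry om om' M ->
  exists f : {lrmorphism qtorus om -> qtorus om'},
    monomial (qexp om) (qexp om') f l M.
Proof.
move=> isoM.
apply: (@twisted_monomial_hom _ _ (bch om) _ (bch om') (mulmxr M)).
- by move=> v w; rewrite /= /bch_factor isoM.
- by move=> v w; rewrite wtD cexpD.
- by rewrite wt0 cexp0.
Qed.

Context (f : {lrmorphism qtorus om -> qtorus om'}) (l : 'I_n -> C)
  (M : 'M[int]_(n, n')) (fE : monomial (qexp om) (qexp om') f l M).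

Lemma monomial_inj : injective (fun v : 'rV[int]_n => v *m M) -> injective f.
Proof.
move=> injM.
exact: (@twisted_monomial_inj _ _ (bch om) _ (bch om') (mulmxr M)
  (fun v => cexp (wt l v)) (fun v => cexp_neq0 (wt l v)) f fE injM).
Qed.

Lemma monomial_bij (N : 'M[int]_(n', n)) :
  injective (fun v : 'rV[int]_n => v *m M) -> N *m M = 1%:M -> bijective f.
Proof.
move=> injM NM; apply: inj_surj_bij; first exact: monomial_inj.
apply: (@twisted_monomial_surj _ _ (bch om) _ (bch om') (mulmxr M)
  (fun v => cexp (wt l v)) (fun v => cexp_neq0 (wt l v)) f fE) => v.
by exists (v *m N); rewrite /= -mulmxA NM mulmx1.
Qed.

End Torus.

Section FractionMaps.
Context {n n' : nat} {om : 'M[C]_n} {om' : 'M[C]_n'}.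
Context {K K' : unitAlgType C} {iota : {lrmorphism qtorus om -> K}}
  {iota' : {lrmorphism qtorus om' -> K'}}.
Hypotheses (HK : skew_field_of_fractions iota)
  (HK' : skew_field_of_fractions iota').
Local Notation e := (fun v => iota (qexp om v)).
Local Notation e' := (fun v => iota' (qexp om' v)).

Lemma fexpM v w : e v * e w = cexp (cform om v w / 2) *: e (v + w).
Proof. by rewrite -rmorphM qexpM /= linearZ_LR. Qed.

(** The product of e^v and e^(-v) carries the factor exp([v, -v] / 2). Since [om] is an arbitrary
    matrix, the vanishing of [v, v] is a hypothesis. *)
Lemma fexpV v : cform om v v = 0 -> (e v)^-1 = e (- v).
Proof.
move=> vv; have cNv : cform om v (- v) = 0.
  by apply: (addrI (cform om v v)); rewrite -cformDr subrr cform0r vv addr0.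
have eVE : e v * e (- v) = 1.
  by rewrite fexpM subrr cNv mul0r cexp0 scale1r rmorph1.
have e_unit : e v \is a GRing.unit.
  by apply: (frac_unit HK); rewrite monalgU_eq0 oner_neq0.
by apply: (mulrI e_unit); rewrite eVE divrr.
Qed.

Lemma torus_frac_hom_uniq (B : algType C) (f g : {lrmorphism K -> B}) :
  (forall i, f (e (delta_mx 0 i)) = g (e (delta_mx 0 i))) -> f =1 g.
Proof.
move=> eq_gen; apply: (frac_hom_uniq HK).
exact: (@qtorus_hom_uniq _ _ B (f \o iota) (g \o iota)).
Qed.

(** The isometry gives a morphism of tori; injectivity keeps the images of denominators nonzero, so
    that it extends to fractions. *)
Lemma torus_frac_hom (l : 'I_n -> C) (M : 'M[int]_(n, n')) :
  cform_isometry om om' M -> injective (fun v : 'rV[int]_n => v *m M) ->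
  exists f : {lrmorphism K -> K'}, monomial e e' f l M.
Proof.
move=> isoM injM; have [f0 f0E] := qtorus_hom l isoM.
have inj0 : injective (iota' \o f0).
  by apply: inj_comp; [exact: frac_inj HK' | exact: monomial_inj f0E injM].
have [f fE] := frac_hom HK (fracU HK') inj0.
by exists f => v; rewrite fE /= f0E linearZ_LR.
Qed.

Lemma torus_frac_bij (l : 'I_n -> C) (M : 'M[int]_(n, n')) (N : 'M[int]_(n', n))
    (f : {lrmorphism K -> K'}) :
  cform_isometry om om' M -> injective (fun v : 'rV[int]_n => v *m M) ->
  N *m M = 1%:M -> monomial e e' f l M -> bijective f.
Proof.
move=> isoM injM NM fE; have [f0 f0E] := qtorus_hom l isoM.
have f0bij := monomial_bij f0E injM NM.
apply: (frac_hom_bij HK HK' _ f0bij).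
apply: (@qtorus_hom_uniq _ _ K' (f \o iota) (iota' \o f0)) => i /=.
by rewrite fE f0E linearZ_LR.
Qed.

End FractionMaps.

End MonomialMaps.

(** * The integer matrices *)

(* Integer matrices given by their lists of rows, on which products can be
   evaluated by computation. *)
Definition imat m n (s : seq (seq int)) : 'M[int]_(m, n) :=
  \matrix_(i, j) (nth [::] s i)`_j.

Definition mkrows m n (F : nat -> nat -> int) : seq (seq int) :=
  mkseq (fun i => mkseq (F i) n) m.

Definition mulrows k (s t : seq (seq int)) (i j : nat) : int :=
  foldr (fun l x => (nth [::] s i)`_l * (nth [::] t l)`_j + x) 0 (iota 0 k).

Lemma imat_mkrows m n (F : nat -> nat -> int) :
  imat m n (mkrows m n F) = \matrix_(i, j) F i j.
Proof. by apply/matrixP => i j; rewrite !mxE !nth_mkseq. Qed.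

Lemma imatM m k n s t :
  imat m k s *m imat k n t = imat m n (mkrows m n (mulrows k s t)).
Proof.
rewrite imat_mkrows; apply/matrixP => i j; rewrite !mxE.
under eq_bigr => l _ do rewrite !mxE.
by rewrite -(big_mkord xpredT (fun l => (nth [::] s i)`_l * (nth [::] t l)`_j))
  unlock /index_iota subn0.
Qed.

Lemma imat_tr m n s :
  (imat m n s)^T = imat n m (mkrows n m (fun i j => (nth [::] s j)`_i)).
Proof. by rewrite imat_mkrows; apply/matrixP => i j; rewrite !mxE. Qed.

Lemma imatD m n s t : imat m n s + imat m n t =
  imat m n (mkrows m n (fun i j => (nth [::] s i)`_j + (nth [::] t i)`_j)).
Proof. by rewrite imat_mkrows; apply/matrixP => i j; rewrite !mxE. Qed.

Lemma imat_scalar n (d : int) :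
  d%:M = imat n n (mkrows n n (fun i j => if i == j then d else 0)).
Proof.
rewrite imat_mkrows; apply/matrixP => i j; rewrite !mxE val_eqE.
by case: (i == j).
Qed.

Ltac imat_compute :=
  rewrite ?imat_scalar ?imat_tr ?imatM; congr (imat _ _);
  vm_compute; reflexivity.

(** This matrix, [BJ2121] and [BW] hold the commutators of the logarithms of the generators, divided
    by hbar; for the quivers the entries are twice [bhat]. *)
Definition BJ1212 : 'M[int]_6 := imat 6 6
  [:: [:: 0; 4; 0; 2; -4; 0];
      [:: -4; 0; 4; 0; 4; -4];
      [:: 0; -4; 0; 0; 0; 2];
      [:: -2; 0; 0; 0; 2; 0];
      [:: 4; -4; 0; -2; 0; 2];
      [:: 0; 4; -2; 0; -2; 0]].

Definition BJ2121 : 'M[int]_6 := imat 6 6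
  [:: [:: 0; 4; 0; -2; 0; 0];
      [:: -4; 0; 4; 4; -4; 0];
      [:: 0; -4; 0; 0; 4; -2];
      [:: 2; -4; 0; 0; 2; 0];
      [:: 0; 4; -4; -2; 0; 2];
      [:: 0; 0; 2; 0; -2; 0]].

Definition BW : 'M[int]_(4 + 4) := imat 8 8
  [:: [:: 0; 0; 0; 0; 1; 0; 0; 0];
      [:: 0; 0; 0; 0; 0; 2; 0; 0];
      [:: 0; 0; 0; 0; 0; 0; 1; 0];
      [:: 0; 0; 0; 0; 0; 0; 0; 2];
      [:: -1; 0; 0; 0; 0; 0; 0; 0];
      [:: 0; -2; 0; 0; 0; 0; 0; 0];
      [:: 0; 0; -1; 0; 0; 0; 0; 0];
      [:: 0; 0; 0; -2; 0; 0; 0; 0]].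

(* The rows are the exponents of the images of the generators, in the
   coordinates p_1, ..., p_4, u_1, ..., u_4. *)
Definition Mphi : 'M[int]_(6, 4 + 4) := imat 6 8
  [:: [:: -2; 1; 0; 0; 0; -1; 0; 0];
      [:: 0; 1; -2; 1; 0; 1; 0; -1];
      [:: 0; 0; 0; 1; 0; 0; 0; 1];
      [:: 1; 0; 0; 0; -1; 0; 0; 0];
      [:: 1; -1; 1; 0; 1; 0; -1; 0];
      [:: 0; 0; 1; -1; 0; 0; 1; 0]].

Definition Mphi' : 'M[int]_(6, 4 + 4) := imat 6 8
  [:: [:: 0; 0; 0; 1; 0; 0; 0; -1];
      [:: 0; 1; -2; 1; 0; -1; 0; 1];
      [:: -2; 1; 0; 0; 0; 1; 0; 0];
      [:: 0; 0; 1; -1; 0; 0; -1; 0];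
      [:: 1; -1; 1; 0; -1; 0; 1; 0];
      [:: 1; 0; 0; 0; 1; 0; 0; 0]].

Definition Mpi : 'M[int]_(4 + 4) := imat 8 8
  [:: [:: 1; 0; 0; 0; 0; 0; 0; 0];
      [:: 2; 0; 0; 1; 0; 0; 0; 0];
      [:: 0; 0; 1; 0; 0; 0; 0; 0];
      [:: -2; 1; 0; 0; 0; 0; 0; 0];
      [:: 0; 0; 0; 0; 1; 1; 0; -1];
      [:: 0; 0; 0; 0; 0; 0; 0; 1];
      [:: 0; 0; 0; 0; 0; 0; 1; 0];
      [:: 0; 0; 0; 0; 0; 1; 0; 0]].

Definition Mtau : 'M[int]_6 := imat 6 6
  [:: [:: 1; 0; 0; 0; 0; 0];
      [:: 0; 1; 0; 0; 0; 0];
      [:: 0; 0; 1; 0; 0; 0];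
      [:: 0; 0; 0; 1; 1; 0];
      [:: 0; -1; 0; 0; -1; 0];
      [:: 0; 1; 0; 0; 1; 1]].

Definition Mswap : 'M[int]_(4 + 4) := imat 8 8
  [:: [:: 1; 0; 0; 0; 0; 0; 0; 0];
      [:: 0; 0; 0; 1; 0; 0; 0; 0];
      [:: 0; 0; 1; 0; 0; 0; 0; 0];
      [:: 0; 1; 0; 0; 0; 0; 0; 0];
      [:: 0; 0; 0; 0; 1; 0; 0; 0];
      [:: 0; 0; 0; 0; 0; 0; 0; 1];
      [:: 0; 0; 0; 0; 0; 0; 1; 0];
      [:: 0; 0; 0; 0; 0; 1; 0; 0]].

(* The derivation ad(p_1 (u_4 - u_2) / hbar) on linear forms. *)
Definition Dshear : 'M[int]_(4 + 4) := imat 8 8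
  [:: [:: 0; 0; 0; 0; 0; 0; 0; 0];
      [:: 2; 0; 0; 0; 0; 0; 0; 0];
      [:: 0; 0; 0; 0; 0; 0; 0; 0];
      [:: -2; 0; 0; 0; 0; 0; 0; 0];
      [:: 0; 0; 0; 0; 0; -1; 0; 1];
      [:: 0; 0; 0; 0; 0; 0; 0; 0];
      [:: 0; 0; 0; 0; 0; 0; 0; 0];
      [:: 0; 0; 0; 0; 0; 0; 0; 0]].

Lemma Mphi_isometry : Mphi *m BW *m Mphi^T = BJ1212.
Proof. by imat_compute. Qed.

Lemma Mphi'_isometry : Mphi' *m BW *m Mphi'^T = BJ2121.
Proof. by imat_compute. Qed.

Lemma Mpi_isometry : Mpi *m BW *m Mpi^T = BW.
Proof. by imat_compute. Qed.

Lemma Mswap_isometry : Mswap *m BW *m Mswap^T = BW.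
Proof. by imat_compute. Qed.

Lemma shear_isometry :
  (1%:M + Dshear) *m BW *m (1%:M + Dshear)^T = BW.
Proof. by rewrite imat_scalar imatD; imat_compute. Qed.

(** The shear comes first and the transposition last, since conjugation by the leftmost factor of
    P^K is applied last. *)
Lemma shear_swap : (1%:M + Dshear) *m Mswap = Mpi.
Proof. by rewrite imat_scalar imatD; imat_compute. Qed.

(** The derivation takes values in the span of p_1 and u_4 - u_2, which it kills; its exponential is
    therefore 1 + [Dshear]. *)
Lemma Dshear_sqr : Dshear *m Dshear = 0.
Proof. by rewrite -[RHS](scale0r 1%:M) scalemx1; imat_compute. Qed.

Lemma Mtau_isometry : Mtau *m BJ1212 *m Mtau^T = BJ2121.
Proof. by imat_compute. Qed.

(** The commutative square of the proposition at the level of exponents; [pi_weights] is its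
    counterpart for the scalars. *)
Lemma Mphi'_pi : Mphi' *m Mpi = Mtau *m Mphi.
Proof. by imat_compute. Qed.

(** The second factor is the inverse of [BJ1212] multiplied by 4 to clear denominators. *)
Lemma BJ1212_nondeg : BJ1212 *m imat 6 6
  [:: [:: 0; -1; -2; 0; 0; -2];
      [:: 1; 0; -1; 2; 1; 0];
      [:: 2; 1; 0; 2; 2; 0];
      [:: 0; -2; -2; 0; -2; -4];
      [:: 0; -1; -2; 2; 0; -2];
      [:: 2; 0; 0; 4; 2; 0]] = 4%:M.
Proof. by imat_compute. Qed.

Lemma BJ2121_nondeg : BJ2121 *m imat 6 6
  [:: [:: 0; -1; -2; 0; -2; -2];
      [:: 1; 0; -1; 0; -1; -2];
      [:: 2; 1; 0; 2; 0; 0];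
      [:: 0; 0; -2; 0; -2; -4];
      [:: 2; 1; 0; 2; 0; -2];
      [:: 2; 2; 0; 4; 2; 0]] = 4%:M.
Proof. by imat_compute. Qed.

Lemma Mpi_invol : Mpi *m Mpi = 1%:M.
Proof. by imat_compute. Qed.

Lemma Mtau_inv : imat 6 6
  [:: [:: 1; 0; 0; 0; 0; 0];
   [:: 0; 1; 0; 0; 0; 0];
   [:: 0; 0; 1; 0; 0; 0];
   [:: 0; 1; 0; 1; 1; 0];
   [:: 0; -1; 0; 0; -1; 0];
   [:: 0; 0; 0; 0; 1; 1]] *m Mtau = 1%:M.
Proof. by imat_compute. Qed.

Lemma BW_nondeg : BW *m imat 8 8
  [:: [:: 0; 0; 0; 0; -2; 0; 0; 0];
      [:: 0; 0; 0; 0; 0; -1; 0; 0];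
      [:: 0; 0; 0; 0; 0; 0; -2; 0];
      [:: 0; 0; 0; 0; 0; 0; 0; -1];
      [:: 2; 0; 0; 0; 0; 0; 0; 0];
      [:: 0; 1; 0; 0; 0; 0; 0; 0];
      [:: 0; 0; 2; 0; 0; 0; 0; 0];
      [:: 0; 0; 0; 1; 0; 0; 0; 0]] = 2%:M.
Proof. by imat_compute. Qed.

(** * The commutator forms as integer matrices scaled by hbar *)

Section Forms.
Context {R : realType} (hbar : R[i]) (lam : 'I_4 -> R[i]).
Local Notation C := R[i].

(** The hypothesis is stated over the rationals, where each entry is decided by computation; the
    embedding into C transports it. *)
Lemma Yform_int (Q : wquiver 6) (s : seq (seq int)) :
  (forall i j, 2 * bhat Q i j = ((nth [::] s i)`_j)%:~R) ->
  Yform hbar Q = hbar *: map_mx intr (imat 6 6 s).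
Proof.
move=> sE; apply/matrixP => i j; rewrite !mxE mulrC.
by rewrite -[X in X * ratr _](ratr_nat C 2) -rmorphM sE /= ratr_int.
Qed.

Lemma Yform_J1212 : Yform hbar J1212 = hbar *: map_mx intr BJ1212.
Proof.
apply: Yform_int => -[[|[|[|[|[|[|//]]]]]] ?] [[|[|[|[|[|[|//]]]]]] ?];
by apply/eqP; vm_compute.
Qed.

Lemma Yform_J2121 : Yform hbar J2121 = hbar *: map_mx intr BJ2121.
Proof.
apply: Yform_int => -[[|[|[|[|[|[|//]]]]]] ?] [[|[|[|[|[|[|//]]]]]] ?];
by apply/eqP; vm_compute.
Qed.

Lemma Wform_int : Wform hbar = hbar *: map_mx intr BW.
Proof.
apply/matrixP => i j; rewrite /Wform /block_mx !mxE.
case: splitP => i' -> ; rewrite mxE; case: splitP => j' ->; rewrite !mxE.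
all: case: i' => [[|[|[|[|//]]]] ?]; case: j' => [[|[|[|[|//]]]] ?] /=.
all: rewrite ?mulr0n ?mulr1n ?oppr0 ?mulr0 ?mulr1 // /Wweight /=.
all: by rewrite ?mulrN ?mulr1 ?mul1r // mulrC.
Qed.

End Forms.

(** * The maps on generators *)

Lemma lbl_val n k : (k <= n)%N -> @lbl n k.+1 = k :> nat.
Proof. by move=> le_kn; rewrite /lbl inordK. Qed.

(** Turns the lists of values in the specifications into pointwise statements: the labels 1, ..., n
    + 1 run through all ordinals. *)
Lemma eq_map_lbl n (T : Type) (f g : 'I_n.+1 -> T) :
  [seq f (lbl k) | k <- iota 1 n.+1] = [seq g (lbl k) | k <- iota 1 n.+1] <->
  f =1 g.
Proof.
split=> [eq_fg i|eq_fg]; last exact: eq_map.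
have := congr1 (fun s => nth (f i) s i) eq_fg.
rewrite !(nth_map 0%N) ?size_iota // nth_iota // add1n.
by have -> : lbl i.+1 = i by apply: val_inj; rewrite /= lbl_val // -ltnS.
Qed.

Ltac row_compute :=
  apply/rowP => -[[|[|[|[|[|[|[|[|//]]]]]]]] ?];
  rewrite ?mulr2n !mxE -?val_eqE /= ?lbl_val //.

Section Specs.
Context {R : realType} (hbar : R[i]) (lam : 'I_4 -> R[i]).
Local Notation C := R[i].
Local Notation L := 'rV[int]_(4 + 4).
Local Notation lm k := (lam (lbl k)).

Definition lphi (i : 'I_6) : C :=
  [:: - lm 2; lm 2 - lm 4; lm 4; - lm 1; lm 1 - lm 3; lm 3]`_i.

Definition lphi' (i : 'I_6) : C :=
  [:: - lm 4; lm 4 - lm 2; lm 2; - lm 3; lm 3 - lm 1; lm 1]`_i.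

(** The list covers only the p_i. The u_i receive the default value 0, as pi^K puts no scalar on
    them. *)
Definition lpi (i : 'I_(4 + 4)) : C :=
  [:: lam2 lam 2 4; lam2 lam 2 4; - lam2 lam 2 4; - lam2 lam 2 4]`_i.

Lemma phi_specE (F Y : algType C) (e : L -> F) (y : 'I_6 -> Y) (phi : Y -> F) :
  phi_spec lam e y phi <->
  forall i, phi (y i) = cexp (lphi i) *: e (row i Mphi).
Proof.
rewrite /phi_spec; set s := (X in _ = X).
suff -> : s = [seq cexp (lphi (lbl k)) *: e (row (lbl k) Mphi) | k <- iota 1 6].
  exact: eq_map_lbl.
rewrite /s /= /lphi !lbl_val //= /kappa ?cexpD ?cexpN.
congr [:: _; _; _; _; _; _]; congr (_ *: e _).
all: row_compute.

Qed.

Lemma phi'_specE (F Y : algType C) (e : L -> F) (y : 'I_6 -> Y)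
    (phi : Y -> F) :
  phi'_spec lam e y phi <->
  forall i, phi (y i) = cexp (lphi' i) *: e (row i Mphi').
Proof.
rewrite /phi'_spec; set s := (X in _ = X).
suff -> : s = [seq cexp (lphi' (lbl k)) *: e (row (lbl k) Mphi') | k <- iota 1 6].
  exact: eq_map_lbl.
rewrite /s /= /lphi' !lbl_val //= /kappa ?cexpD ?cexpN.
by congr [:: _; _; _; _; _; _]; congr (_ *: e _); row_compute.
Qed.

Lemma piK_specE (F : algType C) (e : L -> F) (piK : F -> F) :
  piK_spec lam e piK <->
  forall i, piK (e (delta_mx 0 i)) = cexp (lpi i) *: e (row i Mpi).
Proof.
pose g i := cexp (lpi i) *: e (row i Mpi).
rewrite /piK_spec; set sp := (X in _ = X /\ _); set su := (X in _ /\ _ = X).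
have -> : sp = [seq g (lshift 4 (lbl k)) | k <- iota 1 4].
  rewrite /sp /= /g /lpi /= !lbl_val //=.
  by congr [:: _; _; _; _]; congr (_ *: e _); row_compute.
have -> : su = [seq g (rshift 4 (lbl k)) | k <- iota 1 4].
  rewrite /su /= /g /lpi /= !lbl_val //= cexp0 !scale1r.
  by congr [:: _; _; _; _]; congr (e _); row_compute.
split=> [[eqp equ] i|eqi].
  case: (split_ordP i) => j ->.
    exact: (eq_map_lbl (fun i => piK (e (pvec i))) (fun i => g (lshift 4 i))).1.
  exact: (eq_map_lbl (fun i => piK (e (uvec i))) (fun i => g (rshift 4 i))).1.
by split; apply: eq_map => k; exact: eqi.
Qed.

End Specs.

(** * Adjoint actions *)

Lemma ord4_ind (P : 'I_4 -> Prop) :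
  P (lbl 1) -> P (lbl 2) -> P (lbl 3) -> P (lbl 4) -> forall i, P i.
Proof.
move=> P1 P2 P3 P4 i; have lblE : lbl i.+1 = i.
  by apply: val_inj; rewrite /= lbl_val // -ltnS.
rewrite -lblE; case: i {lblE} => -[|[|[|[|//]]]] ?; assumption.
Qed.

Lemma Mswap_rows i :
  row (lshift 4 i) Mswap = pvec (tperm (lbl 2) (lbl 4) i) /\
  row (rshift 4 i) Mswap = uvec (tperm (lbl 2) (lbl 4) i).
Proof.
move: i; apply: ord4_ind; rewrite permE /= -!val_eqE /= !lbl_val //=.
all: by split; row_compute.
Qed.

Section Lie.
Context {R : realType} {A : algType R[i]}.
Implicit Types X Y Z : A.

Lemma lieC X Y : lie X Y = - lie Y X.
Proof. by rewrite /lie opprB. Qed.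

Lemma lieDr X Y Z : lie X (Y + Z) = lie X Y + lie X Z.
Proof. by rewrite /lie mulrDr mulrDl opprD addrACA. Qed.

Lemma lieNr X Y : lie X (- Y) = - lie X Y.
Proof. by rewrite /lie mulrN mulNr -opprB opprK addrC. Qed.

Lemma lieDl X Y Z : lie (X + Y) Z = lie X Z + lie Y Z.
Proof. by rewrite lieC lieDr opprD -!(lieC _ Z). Qed.

Lemma lieNl X Y : lie (- X) Y = - lie X Y.
Proof. by rewrite lieC lieNr -lieC. Qed.

Lemma lieZl (a : R[i]) X Y : lie (a *: X) Y = a *: lie X Y.
Proof. by rewrite /lie scalerBr scalerAl scalerAr. Qed.

Lemma lieMl X Y Z : lie (X * Y) Z = X * lie Y Z + lie X Z * Y.
Proof. by rewrite /lie mulrBr mulrBl !mulrA addrA subrK. Qed.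

Lemma lie_scalar X (a : R[i]) : lie X a%:A = 0.
Proof. by rewrite /lie -scalerAl -scalerAr mul1r mulr1 subrr. Qed.

End Lie.

Section Adjoint.
Context {R : realType} (hbar : R[i]) (lam : 'I_4 -> R[i]) (hbar0 : hbar != 0).
Local Notation C := R[i].
Local Notation L := 'rV[int]_(4 + 4).
Context {A : algType C} {p u : 'I_4 -> A} (Hpu : heisenberg hbar p u).
Local Notation lin := (lin p u).

Lemma linD v w : lin (v + w) = lin v + lin w.
Proof.
rewrite /Defs.lin -big_split /=; apply: eq_bigr => i _.
by rewrite !mxE !mulrzDr addrACA.
Qed.

Lemma lin0 : lin 0 = 0.
Proof. by apply: (addrI (lin 0)); rewrite -linD !addr0. Qed.

Lemma linN v : lin (- v) = - lin v.
Proof. by apply: (addrI (lin v)); rewrite -linD !subrr lin0. Qed.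

Lemma lin_pvec i : lin (pvec i) = p i.
Proof.
rewrite /Defs.lin (bigD1 i) //= big1 => [|j /negPf ne_ji].
  by rewrite !mxE !eqxx eq_rlshift mulr1z mulr0z !addr0.
by rewrite !mxE eqxx eq_lshift eq_rlshift ne_ji !mulr0z addr0.
Qed.

Lemma lin_uvec i : lin (uvec i) = u i.
Proof.
rewrite /Defs.lin (bigD1 i) //= big1 => [|j /negPf ne_ji].
  by rewrite !mxE !eqxx eq_lrshift mulr1z mulr0z add0r addr0.
by rewrite !mxE eqxx eq_rshift eq_lrshift ne_ji !mulr0z addr0.
Qed.

(** The bracket with [X] is additive, so its values on the p_i and u_i determine it on the lattice;
    [D] records the linear part and [l] the scalar part. *)
Lemma ad_lin X (D : 'M[int]_(4 + 4)) (l : 'I_(4 + 4) -> C) :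
  (forall i, lie X (p i) = lin (row (lshift 4 i) D) + (l (lshift 4 i))%:A) ->
  (forall i, lie X (u i) = lin (row (rshift 4 i) D) + (l (rshift 4 i))%:A) ->
  forall v, lie X (lin v) = lin (v *m D) + (wt l v)%:A.
Proof.
move=> Xp Xu; have X0 : lie X 0 = 0 by rewrite /lie mulr0 mul0r subrr.
have lD v w : lie X (lin v) = lin (v *m D) + (wt l v)%:A ->
    lie X (lin w) = lin (w *m D) + (wt l w)%:A ->
    lie X (lin (v + w)) = lin ((v + w) *m D) + (wt l (v + w))%:A.
  by move=> Pv Pw; rewrite linD lieDr Pv Pw mulmxDl linD wtD scalerDl addrACA.
apply: int_row_ind => [|//|v Pv|i].
- by rewrite lin0 X0 mul0mx lin0 wt0 scale0r addr0.
- rewrite linN lieNr Pv mulNmx linN opprD; congr (_ + _).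
  by apply: (addrI (wt l v)%:A); rewrite subrr -scalerDl -wtD subrr wt0 scale0r.
rewrite wt_delta -rowE; case: (split_ordP i) => j ->.
  by rewrite lin_pvec Xp.
by rewrite lin_uvec Xu.
Qed.

(** Scalars are central, so the assumptions on [D] and [l] make the second iterated bracket vanish,
    and the series stops after its linear term. *)
Lemma exp_ad_lin X (D : 'M[int]_(4 + 4)) (l : 'I_(4 + 4) -> C) :
  (forall v, lie X (lin v) = lin (v *m D) + (wt l v)%:A) ->
  D *m D = 0 -> (forall v, wt l (v *m D) = 0) ->
  forall v, exp_ad X (lin v) (lin (v *m (1%:M + D)) + (wt l v)%:A).
Proof.
move=> XE DD lD v; exists 2; split=> /=.
  by rewrite XE lieDr lie_scalar XE -mulmxA DD mulmx0 lin0 lD scale0r !addr0.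
rewrite !big_ord_recl big_ord0 /= fact0 invr1 !scale1r addr0 XE mulmxDr mulmx1.
by rewrite linD addrA.
Qed.

Definition Xshear : A := hbar^-1 *: (p (lbl 1) * (u (lbl 4) - u (lbl 2))).
Definition Xtrans : A := (lam2 lam 2 4 / (2 * hbar)) *:
  (2 *: u (lbl 3) - 2 *: u (lbl 1) + u (lbl 4) - u (lbl 2)).

Lemma lie_up i j :
  lie (u i) (p j) = - (if j == i then (Wweight j)%:R * hbar else 0)%:A.
Proof. by rewrite lieC (lie_pu Hpu). Qed.

(** Since p_1 commutes with every p_i, only the factor u_4 - u_2 contributes; hence only p_2 and p_4
    move, by multiples of p_1. *)
Lemma lie_Xshear_p i : lie Xshear (p i) =
  (((i == lbl 2)%:R - (i == lbl 4)%:R) * (Wweight i)%:R) *: p (lbl 1).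
Proof.
rewrite lieZl lieMl (lie_pp Hpu) mul0r addr0 lieDl lieNl !lie_up opprK.
rewrite addrC -scalerBl -scalerAr mulr1 scalerA; congr (_ *: _).
have mulrb b x : (if b then x else 0) = b%:R * x :> C.
  by case: b; rewrite ?mul1r ?mul0r.
by rewrite !mulrb; field.
Qed.

Lemma lie_Xshear_u i : lie Xshear (u i) =
  ((i == lbl 1)%:R * (Wweight i)%:R) *: (u (lbl 4) - u (lbl 2)).
Proof.
rewrite lieZl lieMl lieDl lieNl !(lie_uu Hpu) subrr mulr0 add0r (lie_pu Hpu).
rewrite eq_sym -scalerAl mul1r scalerA; congr (_ *: _).
case: eqP => [<-|_]; last by rewrite mulr0 mul0r.
by rewrite mul1r mulrCA mulVf ?mulr1.
Qed.

Lemma ad_shear v : lie Xshear (lin v) = lin (v *m Dshear) + (wt (fun=> 0) v)%:A.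
Proof.
apply: ad_lin => [|]; apply: ord4_ind; rewrite scale0r addr0.
- rewrite lie_Xshear_p -!val_eqE /Wweight /= !lbl_val //= subrr mul0r scale0r.
  by rewrite -[LHS]lin0; congr lin; row_compute.
- rewrite lie_Xshear_p -!val_eqE /Wweight /= !lbl_val //=.
  rewrite subr0 mul1r scaler_nat -lin_pvec -/(p_ 1) !mulr2n -linD.
  by congr lin; row_compute.
- rewrite lie_Xshear_p -!val_eqE /Wweight /= !lbl_val //= subrr mul0r scale0r.
  by rewrite -[LHS]lin0; congr lin; row_compute.
- rewrite lie_Xshear_p -!val_eqE /Wweight /= !lbl_val //=.
  rewrite sub0r mulN1r scaleNr scaler_nat -lin_pvec -/(p_ 1) !mulr2n -linD.
  by rewrite -linN; congr lin; row_compute.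
- rewrite lie_Xshear_u -!val_eqE /Wweight /= !lbl_val //= mul1r scale1r.
  by rewrite -!lin_uvec -linN -linD; congr lin; row_compute.
all: rewrite lie_Xshear_u -!val_eqE /= !lbl_val //= mul0r scale0r.
all: by rewrite -[LHS]lin0; congr lin; row_compute.
Qed.

(** [Xtrans] is linear in the u_j, so the bracket is a scalar. The coefficients 2 of u_1 and u_3
    balance the weights 2 of the indices 2 and 4, giving the same shift up to sign. *)
Lemma lie_Xtrans_p i : lie Xtrans (p i) = (lpi lam (lshift 4 i))%:A.
Proof.
rewrite lieZl !(lieDl, lieNl, lieZl) !lie_up.
rewrite !scalerN !opprK !scalerA -!(scaleNr _ (1 : A)) -!(scalerDl (1 : A)).
rewrite scalerA; congr (_ *: _).
move: i; apply: ord4_ind.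
all: rewrite -!val_eqE /Wweight /lpi /= !lbl_val //=; field.
all: by [].
Qed.

Lemma lie_Xtrans_u i : lie Xtrans (u i) = 0.
Proof.
by rewrite lieZl !(lieDl, lieNl, lieZl) !(lie_uu Hpu) !(scaler0, subr0, addr0).
Qed.

Lemma ad_trans v : lie Xtrans (lin v) = lin (v *m 0) + (wt (lpi lam) v)%:A.
Proof.
apply: ad_lin => i; rewrite row0 lin0 add0r; first exact: lie_Xtrans_p.
(* The positions of the u_i lie beyond the four entries of the list in [lpi]. *)
rewrite lie_Xtrans_u /lpi /= nth_default ?scale0r //.
Qed.

Section Realization.
Context {E : algType C} {e : L -> E}.
Hypothesis hom : forall (l : 'I_(4 + 4) -> C) (M : 'M[int]_(4 + 4)),
  M *m BW *m M^T = BW -> exists f : {lrmorphism E -> E}, monomial e e f l M.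
Hypothesis hom_uniq : forall f g : {lrmorphism E -> E},
  (forall i, f (e (delta_mx 0 i)) = g (e (delta_mx 0 i))) -> f =1 g.

(** Each factor of P^K acts by a monomial map. Existence and uniqueness of such maps are abstracted
    as [hom] and [hom_uniq], so that one proof serves both W(C_2) and its skew field. *)
Lemma Ad_PK (piK : {lrmorphism E -> E}) :
  piK_spec lam e piK -> Ad p u e (PK hbar lam p u) piK.
Proof.
move/piK_specE => piE.
have [bs bsE] := hom (fun=> 0) Mswap_isometry.
have [bh bhE] := hom (fun=> 0) shear_isometry.
(* The translation has zero linear part; 1 + 0 is the form in which [exp_ad_lin] delivers its
   matrix. *)
have iso1 : (1%:M + 0) *m BW *m (1%:M + 0)^T = BW.
  by rewrite addr0 trmx1 mul1mx mulmx1.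
have [bt btE] := hom (lpi lam) iso1.
have wt00 v : wt (fun=> 0) v = 0 :> C.
  by rewrite /wt big1 // => i _; rewrite mulr0.
exists bs, (bh \o bt); split; last first.
- apply: (hom_uniq (g := bs \o (bh \o bt))) => i /=.
  have btbhE : monomial e e (bh \o bt) (lpi lam) (1%:M + Dshear).
    move=> v; rewrite /= (monomial_comp btE bhE) wt00.
    by rewrite (addr0 (wt _ _)) (addr0 1%:M) mulmx1.
  rewrite piE (monomial_comp btbhE bsE) wt00 wt_delta (addr0 (lpi _ _)).
  by rewrite -mulmxA shear_swap rowE.
- exists bh, bt; split=> //; last first.
    exists bt, idfun; split=> // v.
    exists (v *m (1%:M + 0)), (wt (lpi lam) v); split; last exact: btE.
    apply: exp_ad_lin; [exact: ad_trans | exact: mulmx0 |].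
    by move=> w; rewrite mulmx0 wt0.
  move=> v; exists (v *m (1%:M + Dshear)), (wt (fun=> 0) v).
  split; last exact: bhE.
  apply: exp_ad_lin; [exact: ad_shear | exact: Dshear_sqr |].
  by move=> w; exact: wt00.
move=> /= i; split; rewrite bsE wt00 cexp0 scale1r -rowE; congr e.
  exact: (Mswap_rows i).1.
exact: (Mswap_rows i).2.
Qed.

End Realization.

End Adjoint.

(** * Isometry and injectivity of the exponent maps *)

Section Isometries.
Context {R : realType} (hbar : R[i]).

Lemma phi_isometry : cform_isometry (Yform hbar J1212) (Wform hbar) Mphi.
Proof. by rewrite Yform_J1212 Wform_int; exact: isometry_int Mphi_isometry. Qed.

Lemma phi'_isometry : cform_isometry (Yform hbar J2121) (Wform hbar) Mphi'.
Proof. by rewrite Yform_J2121 Wform_int; exact: isometry_int Mphi'_isometry. Qed.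

Lemma tau_isometry : cform_isometry (Yform hbar J2121) (Yform hbar J1212) Mtau.
Proof.
by rewrite Yform_J2121 Yform_J1212; exact: isometry_int Mtau_isometry.
Qed.

Lemma W_isometry M : M *m BW *m M^T = BW ->
  cform_isometry (Wform hbar) (Wform hbar) M.
Proof. by move=> isoM; rewrite Wform_int; exact: isometry_int. Qed.

End Isometries.

Lemma phi_inj : injective (fun v : 'rV[int]_6 => v *m Mphi).
Proof. exact: isometry_inj Mphi_isometry BJ1212_nondeg _. Qed.

Lemma phi'_inj : injective (fun v : 'rV[int]_6 => v *m Mphi').
Proof. exact: isometry_inj Mphi'_isometry BJ2121_nondeg _. Qed.

Lemma tau_inj : injective (fun v : 'rV[int]_6 => v *m Mtau).
Proof. exact: isometry_inj Mtau_isometry BJ2121_nondeg _. Qed.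

Lemma W_inj M : M *m BW *m M^T = BW ->
  injective (fun v : 'rV[int]_(4 + 4) => v *m M).
Proof. by move=> isoM; exact: isometry_inj isoM BW_nondeg _. Qed.

(** * The map tau in monomial form, and the scalars of the square *)

Section Tau.
Context {R : realType} (hbar : R[i]).
Local Notation C := R[i].
Local Notation om := (Yform hbar J1212).

(** Merging the products into single exponentials produces the factors q, q^-2 and q^3, which the
    prefactors q^-1, q^2 and q^-3 cancel exactly. So tau is monomial with zero weights. *)
Lemma tau_specE (Y Y' : unitAlgType C) (e : 'rV[int]_6 -> Y) (y' : 'I_6 -> Y')
    (tau : Y' -> Y) :
  (forall v w, e v * e w = cexp (cform om v w / 2) *: e (v + w)) ->
  (forall v, cform om v v = 0 -> (e v)^-1 = e (- v)) ->
  tau_spec hbar (fun i => e (delta_mx 0 i)) y' tau <->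
  forall i, tau (y' i) = cexp 0 *: e (row i Mtau).
Proof.
move=> eM eV; rewrite /tau_spec /=; set s := (X in _ = X).
suff -> : s = [seq cexp 0 *: e (row (lbl k) Mtau) | k <- iota 1 6].
  exact: (eq_map_lbl (fun i => tau (y' i)) (fun i => cexp 0 *: e (row i Mtau))).
have omE i j : cform om (delta_mx 0 i) (delta_mx 0 j) = hbar * (BJ1212 i j)%:~R.
  by rewrite cform_delta Yform_J1212 !mxE.
have cNl v w : cform om (- v) w = - cform om v w.
  by apply: (addrI (cform om v w)); rewrite -cformDl !subrr cform0l.
have cNr v w : cform om v (- w) = - cform om v w.
  by apply: (addrI (cform om v w)); rewrite -cformDr !subrr cform0r.
have eV_delta i : (e (delta_mx 0 i))^-1 = e (- delta_mx 0 i).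
  apply: eV; rewrite omE mxE.
  by case: i => [[|[|[|[|[|[|//]]]]]] ?]; rewrite mulr0.
rewrite /s !eV_delta !eM -scalerAl !eM !scalerA -!exprVn -!cexpN -!cexpMn.
rewrite -!cexpD !(cNl, cNr, cformDl, omE) !mxE /= !lbl_val //=.
congr [:: _; _; _; _; _; _].
1-3: by rewrite cexp0 scale1r; congr e; row_compute.
all: by congr (cexp _ *: e _); [field | row_compute].
Qed.

Lemma pi_weights (lam : 'I_4 -> C) i :
  lphi' lam i + wt (lpi lam) (row i Mphi') = wt (lphi lam) (row i Mtau).
Proof.
rewrite /wt !big_ord_recl !big_ord0; case: i => [[|[|[|[|[|[|//]]]]]] ?].
all: rewrite !mxE /= /lphi' /lpi /lphi /lam2 /=.
all: by ring.
Qed.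

End Tau.

Theorem proposition3p4 (R : realType) (hbar : R[i]) (lam : 'I_4 -> R[i])
    (* hbar is generic: q = e^hbar is not a root of unity *)
    (hbar_generic : forall n : nat, (0 < n)%N -> cexp hbar ^+ n != 1)
    (Y : unitAlgType R[i]) (jY : {lrmorphism Ytorus hbar J1212 -> Y})
    (HY : skew_field_of_fractions jY)
    (Y' : unitAlgType R[i]) (jY' : {lrmorphism Ytorus hbar J2121 -> Y'})
    (HY' : skew_field_of_fractions jY')
    (F : unitAlgType R[i]) (jF : {lrmorphism WC2 hbar -> F})
    (HF : skew_field_of_fractions jF) :
  let y (i : 'I_6) : Y := jY (Ygen hbar J1212 i) in
  let y' (i : 'I_6) : Y' := jY' (Ygen hbar J2121 i) in
  let e (v : 'rV[int]_(4 + 4)) : F := jF (Wexp hbar v) in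
  (* phi, phi', pi^K_1234 and tau are well defined by their values *)
  [/\ unique_morphism (phi_spec lam e y),
      unique_morphism (phi'_spec lam e y'),
      unique_isomorphism (piK_spec lam (Wexp hbar)),
      unique_isomorphism (piK_spec lam e) &
      unique_isomorphism (tau_spec hbar y y')] /\
  (forall (phi : {lrmorphism Y -> F}) (phi' : {lrmorphism Y' -> F})
          (piK : {lrmorphism F -> F}) (tau : {lrmorphism Y' -> Y}),
     phi_spec lam e y phi -> phi'_spec lam e y' phi' ->
     piK_spec lam e piK -> tau_spec hbar y y' tau ->
     piK \o phi' =1 phi \o tau) /\
  (forall (A : algType R[i]) (p u : 'I_4 -> A), heisenberg hbar p u ->
     (forall piK : {lrmorphism WC2 hbar -> WC2 hbar},
        piK_spec lam (Wexp hbar) piK ->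
        Ad p u (Wexp hbar) (PK hbar lam p u) piK) /\
     (forall piK : {lrmorphism F -> F},
        piK_spec lam e piK -> Ad p u e (PK hbar lam p u) piK)).
Proof.
move=> y y' e.
pose ey v := jY (qexp (Yform hbar J1212) v).
pose ey' v := jY' (qexp (Yform hbar J2121) v).
have Yuniq (f g : {lrmorphism Y -> F}) :
    (forall i, f (y i) = g (y i)) -> f =1 g.
  exact: (torus_frac_hom_uniq HY).
have Y'uniq (B : algType R[i]) (f g : {lrmorphism Y' -> B}) :
    (forall i, f (y' i) = g (y' i)) -> f =1 g.
  exact: (torus_frac_hom_uniq HY').
have Funiq (f g : {lrmorphism F -> F}) :
    (forall i, f (e (delta_mx 0 i)) = g (e (delta_mx 0 i))) -> f =1 g.
  exact: (torus_frac_hom_uniq HF).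
have Wuniq (f g : {lrmorphism WC2 hbar -> WC2 hbar}) :
    (forall i, f (Wexp hbar (delta_mx 0 i)) = g (Wexp hbar (delta_mx 0 i))) ->
    f =1 g.
  exact: qtorus_hom_uniq.
have Fhom (l : 'I_(4 + 4) -> R[i]) M : M *m BW *m M^T = BW ->
    exists f : {lrmorphism F -> F}, monomial e e f l M.
  move=> isoM.
  exact: (torus_frac_hom HF HF l (W_isometry hbar isoM) (W_inj isoM)).
have Whom (l : 'I_(4 + 4) -> R[i]) M : M *m BW *m M^T = BW ->
    exists f : {lrmorphism WC2 hbar -> WC2 hbar},
      monomial (Wexp hbar) (Wexp hbar) f l M.
  by move=> isoM; exact: (qtorus_hom l (W_isometry hbar isoM)).
have tauE (tau : {lrmorphism Y' -> Y}) : tau_spec hbar y y' tau <->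
    forall i, tau (y' i) = cexp 0 *: ey (row i Mtau).
  exact: (tau_specE (e := ey) y' tau (fexpM (iota := jY)) (fexpV HY)).
have [phi0 phi0E] := torus_frac_hom HY HF (lphi lam) (phi_isometry hbar) phi_inj.
have [phi0' phi0'E] :=
  torus_frac_hom HY' HF (lphi' lam) (phi'_isometry hbar) phi'_inj.
have [tau0 tau0E] := torus_frac_hom HY' HY (fun=> 0) (tau_isometry hbar) tau_inj.
have [piF piFE] := Fhom (lpi lam) Mpi Mpi_isometry.
have [piW piWE] := Whom (lpi lam) Mpi Mpi_isometry.
(* Genericity for n = 1 says that q is not 1, whereas hbar = 0 would give q = 1. *)
have hbar0 : hbar != 0.
  by apply: contraTneq (hbar_generic 1%N isT) => ->; rewrite cexp0 expr1n eqxx.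
(* A morphism with the prescribed values equals the constructed one, whose bijectivity follows from
   its matrix; [Mpi] is its own inverse. *)
have bijW (f : {lrmorphism WC2 hbar -> WC2 hbar}) :
    piK_spec lam (Wexp hbar) f -> bijective f.
  move/piK_specE => fE.
  have eq_f : f =1 piW by apply: Wuniq => i; rewrite fE (monomial_gen piWE).
  apply: (eq_bij (monomial_bij piWE (W_inj Mpi_isometry) Mpi_invol)).
  by move=> x; rewrite eq_f.
have bijF (f : {lrmorphism F -> F}) : piK_spec lam e f -> bijective f.
  move/piK_specE => fE.
  have eq_f : f =1 piF by apply: Funiq => i; rewrite fE (monomial_gen piFE).
  apply: (eq_bij (torus_frac_bij HF HF (W_isometry hbar Mpi_isometry)
    (W_inj Mpi_isometry) Mpi_invol piFE)).
  by move=> x; rewrite eq_f.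
have bijT (f : {lrmorphism Y' -> Y}) : tau_spec hbar y y' f -> bijective f.
  move/tauE => fE.
  have eq_f : f =1 tau0.
    by apply: Y'uniq => i; rewrite fE; rewrite (monomial_gen tau0E).
  apply: (eq_bij (torus_frac_bij HY' HY (tau_isometry hbar) tau_inj Mtau_inv
    tau0E)).
  by move=> x; rewrite eq_f.
split; last split.
- split.
  + split; first by exists phi0; apply/phi_specE => i; exact: (monomial_gen phi0E).
    move=> f g /phi_specE fE /phi_specE gE.
    by apply: Yuniq => i; rewrite fE gE.
  + split; first by exists phi0'; apply/phi'_specE => i; exact: (monomial_gen phi0'E).
    move=> f g /phi'_specE fE /phi'_specE gE.
    by apply: Y'uniq => i; rewrite fE gE.
  + split; last exact: bijW; split.
      by exists piW; apply/piK_specE => i; exact: (monomial_gen piWE).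
    move=> f g /piK_specE fE /piK_specE gE.
    by apply: Wuniq => i; rewrite fE gE.
  + split; last exact: bijF; split.
      by exists piF; apply/piK_specE => i; exact: (monomial_gen piFE).
    move=> f g /piK_specE fE /piK_specE gE.
    by apply: Funiq => i; rewrite fE gE.
  + split; last exact: bijT; split.
      by exists tau0; apply/tauE => i; exact: (monomial_gen tau0E).
    move=> f g /tauE fE /tauE gE.
    by apply: Y'uniq => i; rewrite fE gE.
- move=> phi phi' piK tau /phi_specE phiE /phi'_specE phi'E /piK_specE piE.
  move=> /tauE tE.
  (* The specifications fix values at generators only, while the composites evaluate [piK] and [phi]
     at other exponents; the monomial maps supply those values. *)
  have eq_phi : phi =1 phi0.
    by apply: Yuniq => i; rewrite phiE; rewrite (monomial_gen phi0E).
  have eq_phi' : phi' =1 phi0'.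
    by apply: Y'uniq => i; rewrite phi'E; rewrite (monomial_gen phi0'E).
  have eq_pi : piK =1 piF.
    by apply: Funiq => i; rewrite piE (monomial_gen piFE).
  have eq_tau : tau =1 tau0.
    by apply: Y'uniq => i; rewrite tE; rewrite (monomial_gen tau0E).
  apply: (Y'uniq F (piK \o phi') (phi \o tau)) => i /=.
  rewrite eq_phi' eq_pi eq_tau eq_phi.
  have -> := monomial_comp phi0'E piFE (delta_mx 0 i).
  have -> := monomial_comp tau0E phi0E (delta_mx 0 i).
  (* The exponents now agree, and only the logarithms of the scalars remain to be compared. *)
  rewrite -!mulmxA Mphi'_pi -!rowE; congr (cexp _ *: _).
  by rewrite !wt_delta add0r pi_weights.
move=> A p u Hpu; split=> piK piE.
  exact: (Ad_PK hbar0 Hpu Whom Wuniq piE).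
exact: (Ad_PK hbar0 Hpu Fhom Funiq piE).
Qed.
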